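(* The map $J$ sending $r\in B^\infty_\epsilon$ to the Jacobian $J_r\in\mathscr{C}^\infty(\Gamma,\mathbb{R})$ is $\mathscr{C}^\infty$-Gâteaux differentiable, and its first derivative at $r_0\in B^\infty_\epsilon$ is given for $\xi\in\mathscr{C}^\infty_b(\mathbb{R}^3,\mathbb{R}^3)$ by $$\frac{\partial J}{\partial r}[r_0,\xi]=J_{r_0}\,\big(\tau_{r_0}\mathrm{div}_{\Gamma_{r_0}}\tau_{r_0}^{-1}\big)\xi.$$
   Context: Deformations. $\Omega\subset\mathbb{R}^3$ is a bounded domain with smooth ($\mathscr{C}^\infty$), simply connected closed boundary surface $\Gamma$, outer unit normal $\mathbf{n}$. $\mathscr{C}^\infty_b(\mathbb{R}^3,\mathbb{R}^3)$ is the Fréchet space of smooth maps with all derivatives bounded, with seminorms $\|r\|_k=\sup_{0\le p\le k}\sup_x|r^{(p)}(x)|$; $d_\infty$ is the induced metric and $B^\infty_\epsilon=\{r: d_\infty(0,r)<\epsilon\}$, with $\epsilon$ small enough that for all $r\in B^\infty_\epsilon$ the map $\mathrm{I}+r$ is a diffeomorphism of $\Gamma$ onto a smooth closed surface $\Gamma_r=(\mathrm{I}+r)\Gamma$, with outer unit normal $\mathbf{n}_r$. For $u_r$ (scalar or vector valued) defined on $\Gamma_r$, $(\tau_ru_r)(x)=u_r(x+r(x))$, $x\in\Gamma$; $\tau_r^{-1}$ is the inverse; in $\tau_r^{-1}\xi$, $\xi$ denotes the restriction of $\xi$ to $\Gamma$. Jacobian: $J_r=\|\omega_r\|$ with $\omega_r=\det(\mathrm{I}+\mathsf{D}r|_\Gamma)\,(\mathrm{I}+\mathsf{D}r|_\Gamma)^{-T}\mathbf{n}$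 on $\Gamma$, where $\mathsf{D}r$ is the Jacobian matrix of $r$ ($J_r$ is the surface Jacobian of $\mathrm{I}+r:\Gamma\to\Gamma_r$). Surface divergence: for a (not necessarily tangential) vector field $\mathbf{u}$ on $\Gamma_r$ with extension $\tilde{\mathbf{u}}$, $\mathrm{div}_{\Gamma_r}\mathbf{u}=\mathrm{div}\,\tilde{\mathbf{u}}|_{\Gamma_r}-[\nabla\tilde{\mathbf{u}}]\mathbf{n}_r\cdot\mathbf{n}_r$, where $[\nabla\tilde{\mathbf{u}}]$ has $i$-th column $\nabla\tilde u_i$. Gâteaux differentiability. For Fréchet spaces $\mathcal{X},\mathcal{Y}$ and $U\subset\mathcal{X}$, $f:U\to\mathcal{Y}$ is Gâteaux differentiable at $r_0$ if $\frac{\partial f}{\partial r}[r_0,\xi]=\lim_{t\to0}(f(r_0+t\xi)-f(r_0))/t$ exists for all $\xi\in\mathcal{X}$ and is linear and continuous in $\xi$; it is $\mathscr{C}^1$ if this holds at every $r_0\in U$ and $(r_0,\xi)\mapsto\frac{\partial f}{\partial r}[r_0,\xi]$ is continuous; $\mathscr{C}^{m+1}$ if it is $\mathscr{C}^m$ and $r\mapsto\frac{\partial^m f}{\partial r^m}[r,\xi_1,\dots,\xi_m]$ is $\mathscr{C}^1$ for all $\xi_i$; $\mathscr{C}^\infty$ if $\mathscr{C}^m$ for all $m$. *)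

(* Defs.v *)
From HB Require Import structures.
From mathcomp Require Import all_boot all_order all_algebra.
From mathcomp Require Import all_classical all_reals all_analysis.
From mathcomp Require Import ring lra.
Set Implicit Arguments.
Unset Strict Implicit.
Unset Printing Implicit Defensive.
Import Order.TTheory GRing.Theory Num.Theory.
Import numFieldNormedType.Exports.
Local Open Scope classical_set_scope.
Local Open Scope ring_scope.

(* Vectors are rows ('rV[R]_3).  Their library norm is the sup norm; it is only
   used through the topology and differentiability, for which all norms on R^3
   agree.  Lengths are measured with the Euclidean norm [enorm]. *)

Section Euclidean.
Variable R : realType.

Definition dot n (u v : 'rV[R]_n) : R := \sum_i u ord0 i * v ord0 i.

Definition enorm n (u : 'rV[R]_n) : R := Num.sqrt (dot u u).

Lemma enormZ n (a : R) (u : 'rV[R]_n) : enorm (a *: u) = `|a| * enorm u.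
Proof.
rewrite /enorm -sqrtr_sqr -sqrtrM ?sqr_ge0//; congr Num.sqrt.
by rewrite /dot big_distrr; apply: eq_bigr => i _; rewrite !mxE mulrACA expr2.
Qed.

Lemma dot_ge0 n (u : 'rV[R]_n) : 0 <= dot u u.
Proof. by apply: sumr_ge0 => i _; rewrite -expr2 sqr_ge0. Qed.

(* not sharp, but enough for the sum of two bounded maps to be bounded *)
Lemma enormD_le2 n (u v : 'rV[R]_n) : enorm (u + v) <= 2 * (enorm u + enorm v).
Proof.
have uv0 : 0 <= enorm u + enorm v by rewrite addr_ge0 ?sqrtr_ge0.
rewrite -[leRHS]ger0_norm ?mulr_ge0// -sqrtr_sqr ler_sqrt ?sqr_ge0//.
have le2 : dot (u + v) (u + v) <= 2 * (dot u u + dot v v).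
  rewrite /dot -big_split big_distrr; apply: ler_sum => i _ /=.
  rewrite !mxE -!expr2 -subr_ge0.
  rewrite (_ : _ - _ = (u ord0 i - v ord0 i) ^+ 2) ?sqr_ge0//.
  by ring.
apply: le_trans le2 _.
rewrite -(sqr_sqrtr (dot_ge0 u)) -(sqr_sqrtr (dot_ge0 v)) -/(enorm u) -/(enorm v).
move: (sqrtr_ge0 (dot u u)) (sqrtr_ge0 (dot v v)).
rewrite -/(enorm u) -/(enorm v) => u0 v0.
have : 0 <= enorm u * enorm v by rewrite mulr_ge0.
nra.
Qed.

End Euclidean.

Section Smooth.
Variable R : realType.
Implicit Types U W : normedModType R.

(* iterD [:: v1; ...; vp] f x = f^(p)(x)[v1, ..., vp] for f of class C^p *)
Definition iterD U W (vs : seq U) (f : U -> W) : U -> W :=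
  foldr (fun v g => 'D_v g) f vs.

Definition smooth_on U W (O : set U) (f : U -> W) :=
  forall vs x, O x -> differentiable (iterD vs f) x.

Lemma near_eq_differentiable U W (f g : U -> W) (x : U) :
  (\forall y \near x, f y = g y) -> differentiable f x -> differentiable g x.
Proof.
move=> fg df.
have gE : g \o shift x = cst (g x) + 'd f x +o_ 0 id.
  apply/eqaddoP => e e0.
  have /eqaddoP/(_ e e0) := proj2 ((diff_locallyP x f).1 df).
  have : \forall h \near (0 : U), f (h + x) = g (h + x).
    rewrite (near_shift x); apply: filterS fg => y /=.
    by rewrite sub0r subrK.
  apply: filterS2 => h.
  by rewrite /= !fctE /= => -> ; rewrite (nbhs_singleton fg).
apply/diff_locallyP; rewrite (diff_unique (diff_continuous df) gE).
by split=> //; exact: diff_continuous.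
Qed.

Lemma iterDP U W (O : set U) (a : R) (f g : U -> W) : open O ->
  smooth_on O f -> smooth_on O g -> forall vs x, O x ->
  iterD vs (a *: f + g) x = a *: iterD vs f x + iterD vs g x.
Proof.
move=> oO sf sg; elim=> [//|v vs IH] x Ox /=.
rewrite (@near_eq_derive _ _ _ _ (a *: iterD vs f + iterD vs g)); last first.
  have : \forall y \near x, O y by apply: open_nbhs_nbhs.
  by apply: filterS => y /IH.
have df := diff_derivable (v := v) (sf vs x Ox).
have dg := diff_derivable (v := v) (sg vs x Ox).
by rewrite deriveD ?deriveZ//; exact: derivableZ.
Qed.

Lemma smooth_onP U W (O : set U) (a : R) (f g : U -> W) : open O ->
  smooth_on O f -> smooth_on O g -> smooth_on O (a *: f + g).
Proof.
move=> oO sf sg vs x Ox.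
have e : \forall y \near x,
    (a *: iterD vs f + iterD vs g) y = iterD vs (a *: f + g) y.
  have : \forall y \near x, O y by apply: open_nbhs_nbhs.
  by apply: filterS => y Oy /=; rewrite (iterDP a oO sf sg).
apply: near_eq_differentiable e _.
by apply: differentiableD; [apply: differentiableZ; exact: sf|exact: sg].
Qed.

End Smooth.

Section SeminormTopology.
Variables (R : realType) (E : lmodType R) (I : Type) (p : I -> E -> R).

(* The initial topology of this map is the coarsest one for which all the
   functions x |-> p i (x - a) are continuous: the sets [set x | p i (x - a) < e]
   form a subbase, so that for seminorms p i it is the locally convex topology
   defined by the family p. *)
Definition seminorm_map (x : E) : prod_topology (fun _ : I * E => R) :=
  fun ia => p ia.1 (x - ia.2).

End SeminormTopology.

Section Gateaux.
Variables (R : realType) (X Y : preTopologicalLmodType R).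
Implicit Types (U : set X) (f : X -> Y).

Definition gateaux_quotient f (r xi : X) (t : R) : Y :=
  t^-1 *: (f (r + t *: xi) - f r).

(* the limit of the quotient, and the junk value 0 if there is none *)
Definition gateaux f (r xi : X) : Y :=
  xget 0 [set l | gateaux_quotient f r xi @ 0^' --> l].

Definition gateaux_differentiable f (r : X) :=
  [/\ forall xi, exists l : Y, gateaux_quotient f r xi @ 0^' --> l,
      linear (gateaux f r) & continuous (gateaux f r)].

(* Only the values of f on U matter when U is open. *)
Definition gateaux_C1 U f :=
  (forall r, U r -> gateaux_differentiable f r) /\
  {within U `*` [set: X], continuous (fun q : X * X => gateaux f q.1 q.2)}.

(* gateaux_iter f [:: xi1; ...; xim] r = (d^m f / dr^m)[r, xi1, ..., xim] *)
Fixpoint gateaux_iter f (xis : seq X) : X -> Y :=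
  if xis is xi :: s then gateaux_iter (fun r => gateaux f r xi) s else f.

Fixpoint gateaux_C (m : nat) U f :=
  if m is m'.+1 then
    gateaux_C m' U f /\
    forall xis : m'.-tuple X, gateaux_C1 U (gateaux_iter f xis)
  else {within U, continuous f}.

Definition gateaux_Cinfty U f := forall m, gateaux_C m U f.

End Gateaux.

Section BoundedSmooth.
Variable R : realType.
Local Notation V := 'rV[R]_3.

Definition unit_directions (p : nat) : set (seq V) :=
  [set vs | size vs = p /\ {in vs, forall v, enorm v <= 1}].

Definition Cb_pred : {pred V -> V} := fun r => `[<
  smooth_on setT r /\
  forall p, exists M : R, forall vs x, unit_directions p vs ->
    enorm (iterD vs r x) <= M >].

Lemma Cb_submod_closed : submod_closed Cb_pred.
Proof.
have it0 vs x : iterD vs (0 : V -> V) x = 0.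
  elim: vs x => [//|v vs IH] x /=.
  by rewrite (_ : iterD vs 0 = cst 0) ?derive_cst//; apply/funext => y; exact: IH.
split.
  apply/asboolP; split=> [vs x _|p].
    rewrite (_ : iterD vs 0 = cst 0); first exact: differentiable_cst.
    by apply/funext => y; exact: it0.
  by exists 0 => vs x _; rewrite it0 -[X in enorm X](scale0r 0) enormZ normr0 mul0r.
move=> a f g /asboolP[sf bf] /asboolP[sg bg]; apply/asboolP; split.
  exact: (smooth_onP a openT sf sg).
move=> p; have [M fM] := bf p; have [N gN] := bg p.
exists (2 * (`|a| * M + N)) => vs x uvs.
rewrite (iterDP a openT sf sg)//; apply: le_trans (enormD_le2 _ _) _.
by rewrite ler_wpM2l// enormZ lerD ?gN// ler_wpM2l ?fM.
Qed.

HB.instance Definition _ :=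
  GRing.isSubmodClosed.Build R (V -> V) Cb_pred Cb_submod_closed.

(* the space of smooth maps from R^3 to R^3 with all derivatives bounded *)
Record Cb := MkCb { Cb_fun :> V -> V ; _ : Cb_fun \in Cb_pred }.

HB.instance Definition _ := [isSub for Cb_fun].
HB.instance Definition _ := [Choice of Cb by <:].
HB.instance Definition _ := [SubChoice_isSubLmodule of Cb by <:].

(* operator norm of the p-linear map r^(p)(x), for the Euclidean norm *)
Definition der_norm (p : nat) (r : V -> V) (x : V) : R :=
  sup [set enorm (iterD vs r x) | vs in unit_directions p].

Definition Cb_seminorm (k : nat) (r : Cb) : R :=
  sup [set der_norm p r x | p in [set p | (p <= k)%N] & x in [set: V]].

HB.instance Definition _ :=
  Topological.copy Cb (initial_topology (seminorm_map Cb_seminorm)).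

Definition dinfty (r s : Cb) : R :=
  limn (series (fun k => 2 ^- k *
    (Cb_seminorm k (r - s) / (1 + Cb_seminorm k (r - s))))).

Definition Binfty (e : R) : set Cb := [set r | dinfty 0 r < e].

End BoundedSmooth.

Section Surface.
Variable R : realType.
Local Notation V := 'rV[R]_3.
Local Notation V2 := 'rV[R]_2.
Implicit Types (S O : set V) (x : V).

(* f is a smooth extension of u|_S to the neighbourhood O of x *)
Definition local_extension (W : normedModType R) S (u : V -> W) x O (f : V -> W) :=
  [/\ open O, O x, smooth_on O f & forall y, O y -> S y -> f y = u y].

(* smooth maps on an arbitrary subset of R^3, as in Milnor's Topology from the
   differentiable viewpoint; the charts below follow the same convention *)
Definition smooth_map (W : normedModType R) S (u : V -> W) :=
  forall x, S x -> exists O f, local_extension S u x O f.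

Definition diffeomorphism S (F : V -> V) S' :=
  [/\ F @` S = S', smooth_map S F &
      exists2 G, smooth_map S' G & forall x, S x -> G (F x) = x].

(* local parametrization of S: a smooth map from an open set of R^2 onto an open
   subset of S whose inverse is the restriction of a smooth map on an open set *)
Record chart S := Chart {
  chart_dom : set V2 ;
  chart_cod : set V ;
  chart_map : V2 -> V ;
  chart_inv : V -> V2 ;
  chart_dom_open : open chart_dom ;
  chart_cod_open : open chart_cod ;
  chart_map_smooth : smooth_on chart_dom chart_map ;
  chart_inv_smooth : smooth_on chart_cod chart_inv ;
  chart_mapK : forall y, chart_dom y ->
    [/\ chart_cod (chart_map y), S (chart_map y) &
        chart_inv (chart_map y) = y] ;
  chart_invK : forall x, chart_cod x -> S x ->
    chart_dom (chart_inv x) /\ chart_map (chart_inv x) = x }.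

Definition smooth_closed_surface S :=
  [/\ compact S, connected S & forall x, S x -> exists c : chart S, chart_cod c x].

Definition simply_connected S :=
  (forall x y, S x -> S y -> exists g : R -> V,
     [/\ {within `[0, 1], continuous g}, g @` `[0, 1]%classic `<=` S, g 0 = x & g 1 = y])
  /\
  (forall g : R -> V, {within `[0, 1], continuous g} -> g @` `[0, 1]%classic `<=` S ->
     g 0 = g 1 -> exists H : R * R -> V,
     [/\ {within `[0, 1]%classic `*` `[0, 1]%classic, continuous H},
         H @` (`[0, 1]%classic `*` `[0, 1]%classic) `<=` S,
         forall t, 0 <= t <= 1 -> H (0, t) = g t /\ H (1, t) = g 0 &
         forall s, 0 <= s <= 1 -> H (s, 0) = g 0 /\ H (s, 1) = g 0]).

Definition bounded_domain (Omega : set V) :=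
  [/\ Omega !=set0, open Omega, connected Omega & bounded_set Omega].

Definition boundary (A : set V) : set V := closure A `\` interior A.

(* the unbounded part of the complement of S *)
Definition exterior S : set V :=
  [set x | ~ S x /\ ~ bounded_set (connected_component (~` S) x)].

Definition outer_unit_normal S (n : V -> V) := forall x, S x ->
  [/\ enorm (n x) = 1,
      forall (c : chart S) y v, chart_dom c y -> chart_map c y = x ->
        dot (n x) ('D_v (chart_map c) y) = 0 &
      exists2 d : R, 0 < d & forall t, 0 < t < d -> exterior S (x + t *: n x)].

(* The library Jacobian 'J f x acts on the right of row vectors: its i-th column
   is the gradient of the i-th component of f. *)
Definition grad (f : V -> V) x : 'M[R]_3 := 'J f x.
Definition Dmx (f : V -> V) x : 'M[R]_3 := (grad f x)^T.
Definition div (f : V -> V) x : R := \tr (Dmx f x).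

(* The result does not depend on the extension chosen by [get].  On rows, the
   product [grad f] n reads n *m (grad f)^T. *)
Definition surface_div S (n u : V -> V) x : R :=
  let f := get [set f | exists O, local_extension S u x O f] in
  div f x - dot (n x *m (grad f x)^T) (n x).

Definition displace (r : V -> V) x : V := x + r x.

Definition tau T (r : V -> V) (u : V -> T) : V -> T := fun x => u (displace r x).

Definition tau_inv S (r u : V -> V) : V -> V :=
  fun y => u ('pinv_(fun=> 0) S (displace r) y).

(* on rows, A^-T n reads n *m A^-1 *)
Definition omega (n r : V -> V) x : V :=
  let A := 1%:M + Dmx r x in \det A *: (n x *m invmx A).

Definition jac (n r : V -> V) x : R := enorm (omega n r x).

Definition admissible_radius S (e : R) := 0 < e /\
  forall r : Cb R, Binfty e r ->
    diffeomorphism S (displace r) (displace r @` S) /\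
    smooth_closed_surface (displace r @` S).

End Surface.

Section SurfaceFunctions.
Variables (R : realType) (S : set 'rV[R]_3).
Local Notation V := 'rV[R]_3.

(* A function on S is represented by its extension by 0 to R^3. *)
Definition Csurf_pred : {pred V -> R^o} := fun u => `[<
  smooth_map S u /\ forall x, ~ S x -> u x = 0 >].

Lemma Csurf_submod_closed : submod_closed Csurf_pred.
Proof.
split.
  apply/asboolP; split=> // x Sx; exists setT, 0; split=> //; first exact: openT.
  move=> vs y _; have -> : iterD vs (0 : V -> R^o) = cst 0.
    elim: vs => [//|v vs /= ->]; by apply/funext => z; rewrite derive_cst.
  exact: differentiable_cst.
move=> a u v /asboolP[su u0] /asboolP[sv v0]; apply/asboolP; split; last first.
  by move=> x Sx; rewrite !fctE/= u0// v0// scaler0 addr0.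
move=> x Sx.
have [A [f [oA Ax sf fu]]] := su x Sx.
have [B [g [oB Bx sg gv]]] := sv x Sx.
exists (A `&` B), (a *: f + g); split=> //; first exact: openI.
- apply: smooth_onP; first exact: openI.
  + by move=> vs y [Ay _]; exact: sf.
  + by move=> vs y [_ By]; exact: sg.
- by move=> y [Ay By] Sy; rewrite !fctE/= fu// gv.
Qed.

HB.instance Definition _ :=
  GRing.isSubmodClosed.Build R (V -> R^o) Csurf_pred Csurf_submod_closed.

(* the space of smooth real functions on S *)
Record Csurf := MkCsurf { Csurf_fun :> V -> R^o ; _ : Csurf_fun \in Csurf_pred }.

HB.instance Definition _ := [isSub for Csurf_fun].
HB.instance Definition _ := [Choice of Csurf by <:].
HB.instance Definition _ := [SubChoice_isSubLmodule of Csurf by <:].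

(* The usual topology: uniform convergence, on the compact subsets of the
   coordinate patches, of all the partial derivatives in local coordinates. *)
Record Csurf_index := CsurfIndex {
  idx_chart : chart S ;
  idx_compact : set 'rV[R]_2 ;
  idx_word : seq 'I_2 ;
  idx_compactP : compact idx_compact ;
  idx_sub : idx_compact `<=` chart_dom idx_chart }.

Definition Csurf_seminorm (i : Csurf_index) (u : Csurf) : R :=
  sup [set `|iterD [seq delta_mx ord0 j | j <- idx_word i]
                   (u \o chart_map (idx_chart i)) y| | y in idx_compact i].

HB.instance Definition _ :=
  Topological.copy Csurf (initial_topology (seminorm_map Csurf_seminorm)).

(* the element of Csurf with values jac n r x at x \in S, and the junk value 0
   if that function is not smooth *)
Definition Jmap (n : V -> V) (r : Cb R) : Csurf :=
  insubd 0 (jac n r \_ S : V -> R^o).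

End SurfaceFunctions.

(* Main.v *)
(** The proof starts from the identity J_r = sqrt P(r), where P(r) = |n adj(I + Dr)|^2
    is a polynomial in the values on Gamma of the first partial derivatives of r,
    with the coefficients n_i n_j.  These products are smooth in charts, being
    N_i N_j / |N|^2 for the cross product N of two coordinate tangents, so the
    orientation of n plays no role.  Maps from r to a function on Gamma that are built
    from the partial derivatives of r by sums, products, inverses and square roots
    are stable under Gateaux differentiation and continuous for the topology of
    uniform convergence of all derivatives, which gives smoothness.  Finally, with a
    and b the images under I + Dr of two tangent vectors at x, P(r)(x) is a constant
    multiple of |a x b|^2; a variation xi moves a and b at the speeds Ma and Mb, where M
    is the Jacobian matrix of an extension of tau_r^-1 xi, and the formula follows from
    (Ma x b + a x Mb) . (a x b) = |a x b|^2 tr M - M(a x b) . (a x b). *)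

Require Import Defs.
From HB Require Import structures.
From mathcomp Require Import all_boot all_order all_algebra.
From mathcomp Require Import all_classical all_reals all_analysis.
From mathcomp Require Import ring lra.
(* again, because [ssrnat.iterD] now shadows [Defs.iterD] *)
Require Import Defs.
Set Implicit Arguments.
Unset Strict Implicit.
Unset Printing Implicit Defensive.
Import Order.TTheory GRing.Theory Num.Theory.
Import numFieldNormedType.Exports.
Local Open Scope classical_set_scope.
Local Open Scope ring_scope.

(** * Smooth functions *)

(** Three obstacles shape the proof. First, [admissible_radius] makes [I + Dr] injective on tangent
    vectors only, whereas [omega] contains the inverse of the full matrix. Invertibility is
    recovered from a symmetry of the ball: the metric sees only the seminorms, which are invariant
    under conjugation of r by affine Euclidean reflections. Second, the quotients of increments must
    converge together with all their derivatives in charts. The quotient for a sum, product, inverse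
    or root is an algebraic expression in the values and quotients of its parts, so this convergence
    follows from the rules for limits. The formal derivative in a direction xi stays in the same
    syntax, with xi entering through coefficients; all orders are thus covered by one statement.
    Third, the expression obtained for P is a large sum of minors, and its formal derivative is
    never unfolded. Its value at a point is found by computing the limit of the quotients a second
    time, from the form of P in tangent vectors, where the constant factor does not depend on r. *)

Section IteratedDerivatives.
Variables (R : realType) (U W : normedModType R).
Implicit Types (O : set U) (f g : U -> W).

Lemma near_open O (P : U -> Prop) x : open O -> O x ->
  (forall y, O y -> P y) -> \forall y \near x, P y.
Proof.
move=> oO Ox OP; have : \forall y \near x, O y by apply: open_nbhs_nbhs.
exact: filterS.
Qed.

Lemma derive_eq_on O f g v x : open O -> (forall y, O y -> f y = g y) ->
  O x -> 'D_v f x = 'D_v g x.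
Proof. by move=> oO fg Ox; apply: near_eq_derive; exact: near_open oO Ox fg. Qed.

Lemma differentiable_eq_on O f g x : open O -> (forall y, O y -> f y = g y) ->
  O x -> differentiable f x -> differentiable g x.
Proof. by move=> oO fg Ox; apply: near_eq_differentiable; exact: (near_open oO Ox fg). Qed.

Lemma iterD_rcons vs v f : iterD (rcons vs v) f = iterD vs ('D_v f).
Proof. by rewrite /iterD foldr_rcons. Qed.

Lemma iterD_eq_on O f g vs x : open O -> (forall y, O y -> f y = g y) ->
  O x -> iterD vs f x = iterD vs g x.
Proof.
move=> oO fg; elim: vs x => [|v vs IH] x Ox /=; first exact: fg.
by apply: (derive_eq_on _ oO) => //; exact: IH.
Qed.

Lemma smooth_on_eq O f g : open O -> (forall y, O y -> f y = g y) ->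
  smooth_on O f -> smooth_on O g.
Proof.
move=> oO fg sf vs x Ox; apply: (differentiable_eq_on oO _ Ox (sf vs x Ox)) => y Oy.
exact: (iterD_eq_on _ oO).
Qed.

Lemma smooth_on_sub O O' f : O' `<=` O -> smooth_on O f -> smooth_on O' f.
Proof. by move=> O'O sf vs x /O'O; exact: sf. Qed.

Lemma smooth_on_local f O : (forall x, O x -> exists2 A, A x & smooth_on A f) ->
  smooth_on O f.
Proof. by move=> fO vs x /fO[A Ax]; exact. Qed.

Lemma smooth_on_derive O f v : smooth_on O f -> smooth_on O ('D_v f).
Proof. by move=> sf vs x Ox; rewrite -iterD_rcons; exact: sf. Qed.

Lemma smooth_on_differentiable O f x : smooth_on O f -> O x -> differentiable f x.
Proof. by move=> sf; exact: (sf [::]). Qed.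

(** The induction strips the innermost direction, the derivative that acts on f first, so stability
    of the class under one derivative suffices. *)
Lemma smooth_on_ind (P : (U -> W) -> Prop) O :
  (forall f, P f -> forall x, O x -> differentiable f x) ->
  (forall f v, P f -> P ('D_v f)) -> forall f, P f -> smooth_on O f.
Proof.
move=> Pd PD f Pf vs; elim/last_ind: vs f Pf => [|vs v IH] f Pf; first exact: Pd.
by rewrite iterD_rcons; exact/IH/PD.
Qed.

End IteratedDerivatives.

Section Chain.
Variable R : realType.
Implicit Types (m n : nat).

Lemma differentiable_row m n (f : 'rV[R]_m -> 'rV[R]_n) x :
  (forall i, differentiable (fun y => f y ord0 i) x) -> differentiable f x.
Proof.
move=> df; have -> : f = \sum_i (fun y => f y ord0 i *: delta_mx ord0 i).
  by apply/funext => y; rewrite fct_sumE -row_sum_delta.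
by apply: differentiable_sum => i; apply: differentiableZl.
Qed.

Lemma differentiable_entry m n (f : 'rV[R]_m -> 'rV[R]_n) i x :
  differentiable f x -> differentiable (fun y => f y ord0 i) x.
Proof.
move=> df; apply: (@differentiable_comp _ _ _ _ f (fun M : 'rV_n => M ord0 i)) => //.
exact: differentiable_coord.
Qed.

Lemma derive_entry m n (f : 'rV[R]_m -> 'rV[R]_n) v i x :
  differentiable f x -> 'D_v (fun y => f y ord0 i) x = 'D_v f x ord0 i.
Proof. by move=> df; rewrite derive_mx ?mxE//; exact: diff_derivable. Qed.

Lemma iterD_entry m n (O : set 'rV[R]_m) (f : 'rV[R]_m -> 'rV[R]_n) i vs x :
  open O -> smooth_on O f -> O x ->
  iterD vs (fun y => f y ord0 i) x = iterD vs f x ord0 i.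
Proof.
move=> oO sf; elim: vs x => [//|v vs IH] x Ox /=.
rewrite (derive_eq_on _ oO IH Ox) derive_entry//; exact: sf.
Qed.

Lemma smooth_on_entry m n (O : set 'rV[R]_m) (f : 'rV[R]_m -> 'rV[R]_n) i :
  open O -> smooth_on O f -> smooth_on O (fun y => f y ord0 i).
Proof.
move=> oO sf vs x Ox.
apply: (differentiable_eq_on oO _ Ox (differentiable_entry i (sf vs x Ox))).
by move=> y Oy; rewrite (iterD_entry _ _ oO).
Qed.

(** Two statements are proved together: the coordinate formula at a new order uses differentiability
    at the previous order, and then yields it at the new one. *)
Lemma smooth_on_row m n (O : set 'rV[R]_m) (f : 'rV[R]_m -> 'rV[R]_n) :
  open O -> (forall i, smooth_on O (fun y => f y ord0 i)) -> smooth_on O f.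
Proof.
move=> oO sf.
suff H vs : (forall x, O x -> differentiable (iterD vs f) x) /\
    forall i x, O x -> iterD vs (fun y => f y ord0 i) x = iterD vs f x ord0 i.
  by move=> vs x; exact: (H vs).1.
elim: vs => [|v vs [IH1 IH2]].
  by split=> [x Ox|//]; apply: differentiable_row => i; exact: (sf i [::]).
have E i x : O x -> iterD (v :: vs) (fun y => f y ord0 i) x = iterD (v :: vs) f x ord0 i.
  by move=> Ox /=; rewrite (derive_eq_on _ oO (IH2 i) Ox) derive_entry//; exact: IH1.
split=> // x Ox; apply: differentiable_row => i.
exact: (differentiable_eq_on oO (E i) Ox (sf i (v :: vs) x Ox)).
Qed.

Lemma derive_comp m n (W : normedModType R) (h : 'rV[R]_n -> W)
    (g : 'rV[R]_m -> 'rV[R]_n) v x :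
  differentiable g x -> differentiable h (g x) ->
  'D_v (h \o g) x = 'D_('D_v g x) h (g x).
Proof.
move=> dg dh; rewrite !deriveE//; last exact: differentiable_comp.
by rewrite diff_comp.
Qed.

(** Written in coordinates, the chain rule uses only sums, products and coordinate derivatives,
    under which [SmoothCvg] is closed. *)
Lemma derive_comp_sum m n (h : 'rV[R]_n -> R) (g : 'rV[R]_m -> 'rV[R]_n) v x :
  differentiable g x -> differentiable h (g x) ->
  'D_v (h \o g) x =
  \sum_i 'D_v (fun y => g y ord0 i) x * 'D_(delta_mx ord0 i) h (g x).
Proof.
move=> dg dh; rewrite derive_comp// [in LHS]deriveE// (row_sum_delta ('D_v g x)).
rewrite linear_sum; apply: eq_bigr => i _.
by rewrite linearZ/= derive_entry// [in RHS](deriveE _ dh).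
Qed.

End Chain.

(** * Smooth convergence of families of functions *)

Section Families.
Variable R : realType.

(* For continuous limits this is locally uniform convergence, but the usual rules for
   limits of sums, products, inverses and compositions apply to it verbatim. *)
Definition joint_cvg T (F : set_system T) m (u : T -> 'rV[R]_m -> R)
    (u0 : 'rV[R]_m -> R) x :=
  (fun p : T * 'rV[R]_m => u p.1 p.2) @ filter_prod F (nbhs x) --> u0 x.

Definition word n (w : seq 'I_n) : seq 'rV[R]_n := [seq delta_mx ord0 j | j <- w].

(* Stable under differentiation, so that mere joint convergence of its members
   already gives the convergence of all their derivatives. *)
Inductive SmoothCvg T (F : set_system T) m (O : set 'rV[R]_m) :
    (T -> 'rV[R]_m -> R) -> ('rV[R]_m -> R) -> Prop :=
| SmoothCvg_cst g : smooth_on O g -> SmoothCvg F O (fun=> g) g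
| SmoothCvg_comp n (O' : set 'rV[R]_n) h h0 c :
    smooth_on O c -> (forall x, O x -> O' (c x)) ->
    (\forall t \near F, smooth_on O' (h t)) -> smooth_on O' h0 ->
    (forall w z, O' z -> joint_cvg F (fun t => iterD (word w) (h t)) (iterD (word w) h0) z) ->
    SmoothCvg F O (fun t => h t \o c) (h0 \o c)
| SmoothCvg_add u u0 v v0 : SmoothCvg F O u u0 -> SmoothCvg F O v v0 ->
    SmoothCvg F O (fun t x => u t x + v t x) (fun x => u0 x + v0 x)
| SmoothCvg_mul u u0 v v0 : SmoothCvg F O u u0 -> SmoothCvg F O v v0 ->
    SmoothCvg F O (fun t x => u t x * v t x) (fun x => u0 x * v0 x)
| SmoothCvg_inv u u0 : SmoothCvg F O u u0 ->
    (\forall t \near F, forall x, O x -> u t x != 0) ->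
    (forall x, O x -> u0 x != 0) ->
    SmoothCvg F O (fun t x => (u t x)^-1) (fun x => (u0 x)^-1)
| SmoothCvg_sqrt u u0 : SmoothCvg F O u u0 ->
    (\forall t \near F, forall x, O x -> 0 < u t x) ->
    (forall x, O x -> 0 < u0 x) ->
    SmoothCvg F O (fun t x => Num.sqrt (u t x)) (fun x => Num.sqrt (u0 x))
| SmoothCvg_eq u u0 v v0 : SmoothCvg F O u u0 ->
    (\forall t \near F, forall x, O x -> u t x = v t x) ->
    (forall x, O x -> u0 x = v0 x) -> SmoothCvg F O v v0.

Lemma smooth_on_cst m (O : set 'rV[R]_m) (a : R) : smooth_on O (cst a).
Proof.
apply: (@smooth_on_ind _ _ _ (fun f => exists a, f = cst a)); last by exists a.
  by move=> f [b ->] x _; exact: differentiable_cst.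
by move=> f v [b ->]; exists 0; apply/funext => x; rewrite derive_cst.
Qed.

Lemma differentiable_sqrt m (f : 'rV[R]_m -> R) x :
  differentiable f x -> 0 < f x -> differentiable (fun y => Num.sqrt (f y)) x.
Proof.
move=> df fx; apply: (@differentiable_comp _ _ _ _ f Num.sqrt) => //.
by apply/derivable1_diffP; have [] := is_derive1_sqrt fx.
Qed.

Lemma derive_sqrt_comp m (f : 'rV[R]_m -> R) v x :
  differentiable f x -> 0 < f x ->
  'D_v (fun y => Num.sqrt (f y)) x = 2^-1 * (Num.sqrt (f x))^-1 * 'D_v f x.
Proof.
move=> df fx; have ds : differentiable (@Num.sqrt R) (f x).
  by apply/derivable1_diffP; have [] := is_derive1_sqrt fx.
rewrite !deriveE//; last exact: differentiable_sqrt.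
rewrite (_ : (fun y => _) = Num.sqrt \o f)// diff_comp//= diff1E//.
by rewrite derive1E derive_sqrt// invfM -[_ *: _]/(_ * _) mulrC.
Qed.

Variables (T : Type) (F : set_system T).
Context {FF : Filter F}.
Variables (m : nat) (O : set 'rV[R]_m).
Hypothesis oO : open O.

Lemma SmoothCvg_sum (I : Type) (s : seq I) (u : I -> T -> 'rV[R]_m -> R)
    (u0 : I -> 'rV[R]_m -> R) :
  (forall i, SmoothCvg F O (u i) (u0 i)) ->
  SmoothCvg F O (fun t x => \sum_(i <- s) u i t x) (fun x => \sum_(i <- s) u0 i x).
Proof.
move=> Fu; elim: s => [|i s IH].
  apply: (@SmoothCvg_eq _ _ _ _ (fun=> cst 0) (cst 0)).
    exact: SmoothCvg_cst (smooth_on_cst 0).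
    by apply: nearW => t x _; rewrite big_nil.
  by move=> x _; rewrite big_nil.
apply: (SmoothCvg_eq (SmoothCvg_add (Fu i) IH)).
  by apply: nearW => t x _; rewrite big_cons.
by move=> x _; rewrite big_cons.
Qed.

Lemma SmoothCvg_differentiable u u0 : SmoothCvg F O u u0 ->
  (\forall t \near F, forall x, O x -> differentiable (u t) x) /\
  (forall x, O x -> differentiable u0 x).
Proof.
elim=> {u u0} [g sg|n O' h h0 c sc cO sh sh0 _|u u0 v v0 _ [du du0] _ [dv dv0]|
  u u0 v v0 _ [du du0] _ [dv dv0]|u u0 _ [du du0] un un0|
  u u0 _ [du du0] un un0|u u0 v v0 _ [du du0] uv uv0]; split.
- by apply: nearW => t x; exact: (sg [::]).
- by move=> x; exact: (sg [::]).
- apply: filterS sh => t sh x Ox.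
  by apply: differentiable_comp; [exact: (sc [::])|apply: (sh [::]); exact: cO].
- move=> x Ox.
  by apply: differentiable_comp; [exact: (sc [::])|apply: (sh0 [::]); exact: cO].
- apply: filterS2 du dv => t du dv x Ox.
  by apply: differentiableD; [exact: du|exact: dv].
- by move=> x Ox; apply: differentiableD; [exact: du0|exact: dv0].
- apply: filterS2 du dv => t du dv x Ox.
  by apply: differentiableM; [exact: du|exact: dv].
- by move=> x Ox; apply: differentiableM; [exact: du0|exact: dv0].
- apply: filterS2 du un => t du un x Ox.
  by apply: differentiableV; [exact: du|exact: un].
- by move=> x Ox; apply: differentiableV; [exact: du0|exact: un0].
- apply: filterS2 du un => t du un x Ox.
  by apply: differentiable_sqrt; [exact: du|exact: un].
- by move=> x Ox; apply: differentiable_sqrt; [exact: du0|exact: un0].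
- apply: filterS2 du uv => t du uv x Ox.
  by apply: (differentiable_eq_on oO uv Ox); exact: du.
- by move=> x Ox; apply: (differentiable_eq_on oO uv0 Ox); exact: du0.
Qed.

Lemma SmoothCvg_joint_cvg u u0 : SmoothCvg F O u u0 -> forall x, O x -> joint_cvg F u u0 x.
Proof.
elim=> {u u0} [g sg|n O' h h0 c sc cO sh sh0 cvh|u u0 v v0 _ cu _ cv|
  u u0 v v0 _ cu _ cv|u u0 _ cu _ un0|u u0 _ cu _ un0|u u0 v v0 _ cu uv uv0] x Ox.
- have /differentiable_continuous cg := sg [::] x Ox.
  exact: (@cvg_comp _ _ _ snd g _ (nbhs x) _ cvg_snd cg).
- have /differentiable_continuous cc := sc [::] x Ox.
  have ck : (fun p : T * 'rV[R]_m => (p.1, c p.2)) @ filter_prod F (nbhs x) -->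
      filter_prod F (nbhs (c x)).
    apply: (@cvg_pair _ _ _ _ F (nbhs (c x)) _ _ _ fst (c \o snd)).
      exact: cvg_fst.
    exact: (@cvg_comp _ _ _ snd c _ (nbhs x) _ cvg_snd cc).
  exact: cvg_comp ck (cvh [::] _ (cO _ Ox)).
- by apply: cvgD; [exact: cu|exact: cv].
- by apply: cvgM; [exact: cu|exact: cv].
- by apply: cvgV; [exact: un0|exact: cu].
- apply: (@cvg_comp _ _ _ (fun p : T * 'rV[R]_m => u p.1 p.2) Num.sqrt).
    exact: cu.
  exact: sqrt_continuous.
- rewrite /joint_cvg -uv0//; apply: cvg_trans (cu x Ox); apply: near_eq_cvg.
  exists (fun t => forall x, O x -> u t x = v t x, O) => /=.
    by split=> //; exact: open_nbhs_nbhs.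
  by move=> [t y] /= [uvt Oy]; exact: uvt.
Qed.

(** Every differentiation rule stays inside the constructors. For a composition, the hypothesis on
    words absorbs a coordinate derivative of h as one more letter. *)
Lemma SmoothCvg_derive u u0 v : SmoothCvg F O u u0 -> SmoothCvg F O (fun t => 'D_v (u t)) ('D_v u0).
Proof.
elim=> {u u0} [g sg|n O' h h0 c sc cO sh sh0 cvh|u u0 w w0 Fu Du Fw Dw|
  u u0 w w0 Fu Du Fw Dw|u u0 Fu Du un un0|u u0 Fu Du un un0|u u0 w w0 Fu Du uw uw0].
- exact/SmoothCvg_cst/smooth_on_derive.
- have di i : SmoothCvg F O (fun t x => 'D_v (fun y => c y ord0 i) x *
      ('D_(delta_mx ord0 i) (h t) \o c) x)
      (fun x => 'D_v (fun y => c y ord0 i) x * ('D_(delta_mx ord0 i) h0 \o c) x).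
    apply: SmoothCvg_mul; first by apply/SmoothCvg_cst/smooth_on_derive/smooth_on_entry.
    apply: (@SmoothCvg_comp _ _ _ _ n O' (fun t => 'D_(delta_mx ord0 i) (h t))
      ('D_(delta_mx ord0 i) h0) c) => //.
    + by apply: filterS sh => t sh; exact: smooth_on_derive.
    + exact: smooth_on_derive.
    + by move=> w z Oz; have := cvh (rcons w i) z Oz; rewrite /word map_rcons;
        under [X in joint_cvg _ X]eq_fun do rewrite iterD_rcons; rewrite iterD_rcons.
  apply: (SmoothCvg_eq (SmoothCvg_sum (index_enum 'I_n) di)).
    apply: filterS sh => t sh x Ox; rewrite derive_comp_sum//.
      exact: smooth_on_differentiable Ox.
    by apply: smooth_on_differentiable sh _; exact: cO.
  move=> x Ox; rewrite derive_comp_sum//.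
    exact: smooth_on_differentiable Ox.
  by apply: smooth_on_differentiable sh0 _; exact: cO.
- have [du du0] := SmoothCvg_differentiable Fu; have [dw dw0] := SmoothCvg_differentiable Fw.
  apply: (SmoothCvg_eq (SmoothCvg_add Du Dw)).
    apply: filterS2 du dw => t du dw x Ox.
    by rewrite deriveD//; apply/diff_derivable; [exact: du|exact: dw].
  move=> x Ox; rewrite deriveD//; apply/diff_derivable; [exact: du0|exact: dw0].
- have [du du0] := SmoothCvg_differentiable Fu; have [dw dw0] := SmoothCvg_differentiable Fw.
  apply: (SmoothCvg_eq (SmoothCvg_add (SmoothCvg_mul Fu Dw) (SmoothCvg_mul Fw Du))).
    apply: filterS2 du dw => t du dw x Ox.
    by rewrite deriveM//; apply/diff_derivable; [exact: du|exact: dw].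
  by move=> x Ox; rewrite deriveM//; apply/diff_derivable; [exact: du0|exact: dw0].
- have [du du0] := SmoothCvg_differentiable Fu; have Fi := SmoothCvg_inv Fu un un0.
  have Fc := SmoothCvg_mul (SmoothCvg_cst F (smooth_on_cst (-1))) (SmoothCvg_mul Fi Fi).
  apply: (SmoothCvg_eq (SmoothCvg_mul Fc Du)).
    apply: filterS2 du un => t du un x Ox.
    rewrite deriveV ?un//; last exact/diff_derivable/du.
    by rewrite -invfM -expr2 mulN1r.
  move=> x Ox; rewrite deriveV ?un0//; last exact/diff_derivable/du0.
  by rewrite -invfM -expr2 mulN1r.
- have [du du0] := SmoothCvg_differentiable Fu; have Fs := SmoothCvg_sqrt Fu un un0.
  have Fi : SmoothCvg F O (fun t x => (Num.sqrt (u t x))^-1) (fun x => (Num.sqrt (u0 x))^-1).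
    apply: SmoothCvg_inv Fs _ _.
      by apply: filterS un => t un x Ox; rewrite gt_eqF// sqrtr_gt0; exact: un.
    by move=> x Ox; rewrite gt_eqF// sqrtr_gt0; exact: un0.
  have Fc := SmoothCvg_mul (SmoothCvg_cst F (smooth_on_cst 2^-1)) Fi.
  apply: (SmoothCvg_eq (SmoothCvg_mul Fc Du)).
    by apply: filterS2 du un => t du un x Ox; apply/esym/derive_sqrt_comp; [exact: du|exact: un].
  by move=> x Ox; apply/esym/derive_sqrt_comp; [exact: du0|exact: un0].
- apply: (SmoothCvg_eq Du).
    by apply: filterS uw => t uw x Ox; exact: (derive_eq_on _ oO uw Ox).
  by move=> x Ox; exact: (derive_eq_on _ oO uw0 Ox).
Qed.

Lemma SmoothCvg_iterD u u0 vs : SmoothCvg F O u u0 ->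
  SmoothCvg F O (fun t => iterD vs (u t)) (iterD vs u0).
Proof. by move=> Fu; elim: vs => [//|v vs IH] /=; exact: SmoothCvg_derive. Qed.

Lemma SmoothCvg_smooth u u0 : SmoothCvg F O u u0 -> smooth_on O u0.
Proof. by move=> Fu vs; have [] := SmoothCvg_differentiable (SmoothCvg_iterD vs Fu). Qed.

End Families.

Section SmoothOn.
Variables (R : realType) (m : nat) (O : set 'rV[R]_m).
Hypothesis oO : open O.
Implicit Types f g : 'rV[R]_m -> R.

(** A smooth function is a constant family along the filter of a one-point type, so the closure
    rules for smooth functions are instances of those for [SmoothCvg]. *)
Let smooth_cvg_cst f : smooth_on O f -> SmoothCvg (globally [set: unit]) O (fun=> f) f.
Proof. exact: SmoothCvg_cst. Qed.

Lemma smooth_on_mul f g : smooth_on O f -> smooth_on O g ->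
  smooth_on O (fun x => f x * g x).
Proof.
move=> /smooth_cvg_cst Ff /smooth_cvg_cst Fg.
exact: (SmoothCvg_smooth oO (SmoothCvg_mul Ff Fg)).
Qed.

Lemma smooth_on_add f g : smooth_on O f -> smooth_on O g ->
  smooth_on O (fun x => f x + g x).
Proof.
move=> /smooth_cvg_cst Ff /smooth_cvg_cst Fg.
exact: (SmoothCvg_smooth oO (SmoothCvg_add Ff Fg)).
Qed.

Lemma smooth_on_inv f : smooth_on O f -> (forall x, O x -> f x != 0) ->
  smooth_on O (fun x => (f x)^-1).
Proof.
move=> /smooth_cvg_cst Ff f0.
have nf : \forall t \near globally [set: unit], forall x, O x -> f x != 0 by exact: nearW.
exact: (SmoothCvg_smooth oO (SmoothCvg_inv Ff nf f0)).
Qed.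

Lemma smooth_on_comp n (O' : set 'rV[R]_n) (h : 'rV[R]_n -> R)
    (c : 'rV[R]_m -> 'rV[R]_n) :
  smooth_on O c -> smooth_on O' h -> (forall x, O x -> O' (c x)) ->
  smooth_on O (h \o c).
Proof.
move=> sc sh cO; have : SmoothCvg (globally [set: unit]) O (fun=> h \o c) (h \o c).
  apply: (@SmoothCvg_comp _ _ _ _ _ n O' (fun=> h) h c) => //.
  move=> w z Oz; have /differentiable_continuous ch := sh (word R w) z Oz.
  exact: (@cvg_comp _ _ _ snd _ _ (nbhs z) _ cvg_snd ch).
exact: (SmoothCvg_smooth oO).
Qed.

End SmoothOn.

Lemma smooth_on_compV (R : realType) m n p (O : set 'rV[R]_m) (O' : set 'rV[R]_n)
    (h : 'rV[R]_n -> 'rV[R]_p) (c : 'rV[R]_m -> 'rV[R]_n) :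
  open O -> open O' -> smooth_on O c -> smooth_on O' h ->
  (forall x, O x -> O' (c x)) -> smooth_on O (h \o c).
Proof.
move=> oO oO' sc sh cO; apply: smooth_on_row => // i.
exact: (smooth_on_comp oO sc (smooth_on_entry i oO' sh) cO).
Qed.

(** * Smooth functions on a surface *)

Section SeminormTopologyFacts.
Variables (R : realType) (E : lmodType R) (I : Type) (p : I -> E -> R).
Local Notation ET := (initial_topology (seminorm_map p)).

Lemma initial_cvg (S : choiceType) (Y : topologicalType) (f : S -> Y)
    (G : set_system S) (s : S) : Filter G ->
  f @ G --> f s -> G --> (s : initial_topology f).
Proof.
move=> FG fG A /=; rewrite (@nbhsE (initial_topology f)) => -[_ [[C oC <-] /= Cs] CA].
by apply: filterS CA _; apply: fG; exact: open_nbhs_nbhs.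
Qed.

(** All centres a occur because they define the subbase; later estimates must therefore compare
    [p i (u t - a)] with [p i (u0 - a)]. *)
Lemma seminorm_cvgP T (F : set_system T) (FF : Filter F) (u : T -> E) (u0 : E) :
  u @ F --> (u0 : ET) <->
  forall i a, (fun t => p i (u t - a)) @ F --> p i (u0 - a).
Proof.
split=> [uu0 i a|pu].
  have uc := @initial_continuous _ _ (seminorm_map p) u0.
  have := cvg_comp _ _ uu0 uc => /cvg_sup/(_ (i, a)) sc.
  have pc := @initial_continuous _ _ (@^~ (i, a) : (I * E -> R) -> R) (seminorm_map p u0).
  exact: (cvg_comp _ _ sc pc).
apply: initial_cvg; apply/cvg_sup => -[i a].
apply: initial_cvg; exact: (pu i a).
Qed.

End SeminormTopologyFacts.

Section SurfaceSpace.
Variables (R : realType) (S : set 'rV[R]_3).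
Local Notation V := 'rV[R]_3.
Implicit Types (u v : Csurf S) (g : V -> R) (c : chart S).

(** Reading smoothness in coordinates spares the choice of local extensions in the limit
    arguments. *)
Definition chart_smooth g := forall c, smooth_on (chart_dom c) (g \o chart_map c).

Lemma chart_dom_chart_map c y : chart_dom c y -> S (chart_map c y).
Proof. by move=> /chart_mapK[]. Qed.

Lemma open_preimage_on (m n : nat) (O : set 'rV[R]_m) (f : 'rV[R]_m -> 'rV[R]_n) A :
  open O -> open A -> smooth_on O f -> open (O `&` f @^-1` A).
Proof.
move=> oO oA sf; rewrite openE => x [Ox Afx]; apply: filterI.
  exact: open_nbhs_nbhs.
have /differentiable_continuous cf := sf [::] x Ox.
by apply: cf; exact: open_nbhs_nbhs.
Qed.

Lemma smooth_map_chart_smooth (g : V -> R^o) : smooth_map S g -> chart_smooth g.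
Proof.
move=> sg c; apply: smooth_on_local => y cy.
have [A [f [oO Ox sf fg]]] := sg _ (chart_dom_chart_map cy).
have oD := open_preimage_on (@chart_dom_open _ _ c) oO (@chart_map_smooth _ _ c).
exists (chart_dom c `&` chart_map c @^-1` A) => //.
apply: (@smooth_on_eq _ _ _ _ (f \o chart_map c)) => //.
  by move=> z [cz Oz] /=; apply: fg => //; exact: chart_dom_chart_map.
apply: (smooth_on_comp oD _ sf) => [|z []//].
by apply: smooth_on_sub (@chart_map_smooth _ _ c) => z [].
Qed.

(** The extension is g composed with [chart_map c \o chart_inv c], which is defined on an open set
    of space and fixes the points of S in it. *)
Lemma chart_smooth_map (g : V -> R^o) : (forall x, S x -> exists c : chart S, chart_cod c x) ->
  chart_smooth g -> smooth_map S g.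
Proof.
move=> hS sg x Sx; have [c cx] := hS x Sx.
have oD := open_preimage_on (@chart_cod_open _ _ c) (@chart_dom_open _ _ c)
  (@chart_inv_smooth _ _ c).
exists (chart_cod c `&` chart_inv c @^-1` chart_dom c), ((g \o chart_map c) \o chart_inv c).
have [dx _] := chart_invK cx Sx.
split=> //.
- apply: (smooth_on_comp oD _ (sg c)) => [|z []//].
  by apply: smooth_on_sub (@chart_inv_smooth _ _ c) => z [].
- by move=> y [cy dy] Sy /=; have [_ ->] := chart_invK cy Sy.
Qed.

Lemma Csurf_smooth u : smooth_map S u.
Proof. by case: u => u /= /asboolP[]. Qed.

Lemma Csurf_out u x : ~ S x -> u x = 0.
Proof. by case: u => u /= /asboolP[_]; exact. Qed.

Lemma Csurf_eq u v : (forall x, S x -> u x = v x) -> u = v.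
Proof.
move=> uv; apply: val_inj; apply/funext => x /=.
by have [/uv//|nSx] := pselect (S x); rewrite !Csurf_out.
Qed.

(** Has the shape of [Jmap], so that [Jmap S n r] is [to_Csurf S (jac n r)] by conversion. *)
Definition to_Csurf g : Csurf S := insubd 0 (g \_ S : V -> R^o).

Lemma to_CsurfE (g : V -> R^o) x : smooth_map S g -> S x -> to_Csurf g x = g x.
Proof.
move=> sg Sx; rewrite /to_Csurf -[LHS]/(val _ x) insubdK; first by rewrite patchT// inE.
apply/asboolP; split=> [y Sy|y nSy]; last by rewrite patchC// inE.
have [A [f [oO Oy sf fg]]] := sg _ Sy; exists A, f; split=> // z Oz Sz.
by rewrite patchT ?inE//; exact: fg.
Qed.

Lemma to_Csurf_eq g h : (forall x, S x -> g x = h x) -> to_Csurf g = to_Csurf h.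
Proof.
by move=> gh; congr insubd; apply/funext => x; rewrite !patchE; case: ifPn => // /set_mem/gh.
Qed.

Lemma Csurf_subE u v x : (u - v) x = u x - v x.
Proof. by []. Qed.

Lemma Csurf_scaleE (a : R) u x : (a *: u) x = a * u x.
Proof. by []. Qed.

Lemma Csurf_addE u v x : (u + v) x = u x + v x.
Proof. by []. Qed.

End SurfaceSpace.

(** * Convergence in the space of smooth functions on a surface *)

Section SurfaceConvergence.
Variables (R : realType) (S : set 'rV[R]_3).
Local Notation V := 'rV[R]_3.
Implicit Types (c : chart S).

(** A bound for f gives one for g by closeness; for empty K both suprema are the same default
    value. *)
Lemma sup_dist (Y : Type) (K : set Y) (f g : Y -> R) e : 0 <= e ->
  has_ubound [set f y | y in K] -> (forall y, K y -> `|f y - g y| <= e) ->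
  `|sup [set f y | y in K] - sup [set g y | y in K]| <= e.
Proof.
move=> e0 [M fM] fg; have [->|/set0P[y0 Ky0]] := eqVneq K set0.
  by rewrite !image_set0 subrr normr0.
have gM : has_ubound [set g y | y in K].
  exists (M + e) => _ [y Ky <-]; have := fg y Ky; have := fM _ (ex_intro2 _ _ y Ky erefl).
  by rewrite ler_distl; lra.
have supf y : K y -> f y <= sup [set f y | y in K].
  by move=> Ky; apply: ub_le_sup; [exists M|exists y].
have supg y : K y -> g y <= sup [set g y | y in K].
  by move=> Ky; apply: ub_le_sup => //; exists y.
rewrite ler_distl; apply/andP; split.
  rewrite lerBlDr; apply: ge_sup; first by exists (g y0), y0.
  by move=> _ [y Ky <-]; have := fg y Ky; have := supf y Ky; rewrite ler_distl; lra.
apply: ge_sup; first by exists (f y0), y0.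
by move=> _ [y Ky <-]; have := fg y Ky; have := supg y Ky; rewrite ler_distl; lra.
Qed.

Lemma compact_joint_cvg T (F : set_system T) (FF : Filter F) m (K : set 'rV[R]_m)
    (u : T -> 'rV[R]_m -> R) u0 (e : R) : 0 < e -> compact K ->
  (forall y, K y -> {for y, continuous u0}) ->
  (forall y, K y -> joint_cvg F u u0 y) ->
  \forall t \near F, forall y, K y -> `|u t y - u0 y| <= e.
Proof.
(* Compactness in near-covering form merges the product neighbourhoods given by joint convergence at
   the points of K into one member of F. *)
move=> e0 cK cu0 cu; have := (compact_near_coveringP K).1 cK T F
  (fun t y => `|u t y - u0 y| <= e) FF; apply => y Ky.
have e2 : 0 < e / 2 by rewrite divr_gt0.
have /cvgrPdist_lt/(_ _ e2) c1 := cu y Ky.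
have /cvgrPdist_lt/(_ _ e2) c2 := cu0 y Ky.
have c3 : \forall p \near filter_prod F (nbhs y), `|u0 y - u0 p.2| < e / 2.
  exact: (@cvg_snd T 'rV[R]_m F (nbhs y) FF _ c2).
have : \forall p \near filter_prod F (nbhs y), `|u p.1 p.2 - u0 p.2| <= e.
  apply: filterS2 c1 c3 => p h1 h2.
  rewrite (_ : u p.1 p.2 - u0 p.2 = (u0 y - u0 p.2) - (u0 y - u p.1 p.2)); last by ring.
  by apply: le_trans (ler_normB _ _) _; rewrite [leRHS]splitr lerD ?ltW.
case=> -[A B] /= [FA nB] AB; exists (B, A) => //= -[y' t] /= [By' At].
by apply: (AB (t, y')).
Qed.

Lemma Csurf_iterD_sub (u v : Csurf S) c vs y : chart_dom c y ->
  iterD vs ((u - v : Csurf S) \o chart_map c) y =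
  iterD vs (u \o chart_map c) y - iterD vs (v \o chart_map c) y.
Proof.
move=> dy; have su : smooth_on (chart_dom c) (u \o chart_map c).
  exact: smooth_map_chart_smooth (Csurf_smooth u) _.
have sv : smooth_on (chart_dom c) (v \o chart_map c).
  exact: smooth_map_chart_smooth (Csurf_smooth v) _.
rewrite (_ : _ \o _ = (-1) *: (v \o chart_map c) + (u \o chart_map c)); last first.
  by apply/funext => z /=; rewrite !fctE /= scaleN1r addrC.
by rewrite (iterDP (-1) (@chart_dom_open _ _ c))// scaleN1r addrC.
Qed.

(** Joint convergence of the coordinate derivatives is uniform on the compact sets of the seminorms,
    and the reverse triangle inequality removes the centre a. *)
Lemma Csurf_cvg T (F : set_system T) (FF : Filter F) (u : T -> Csurf S) (u0 : Csurf S) :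
  (forall c w y, chart_dom c y ->
    joint_cvg F (fun t => iterD (word R w) (u t \o chart_map c))
           (iterD (word R w) (u0 \o chart_map c)) y) ->
  u @ F --> u0.
Proof.
move=> cu; apply/(seminorm_cvgP (@Csurf_seminorm R S)) => -[c K w cK sK] a.
rewrite /Csurf_seminorm /=.
set f := fun t y => `|iterD (word R w) ((u t - a : Csurf S) \o chart_map c) y|.
set f0 := fun y => `|iterD (word R w) ((u0 - a : Csurf S) \o chart_map c) y|.
have sa v : smooth_on (chart_dom c) ((v : Csurf S) \o chart_map c).
  exact: (smooth_map_chart_smooth (Csurf_smooth v)).
have cf (v : Csurf S) y : K y -> {for y, continuous (iterD (word R w) (v \o chart_map c))}.
  by move=> /sK dy; exact/differentiable_continuous/sa.
have bf0 : has_ubound [set f0 y | y in K].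
  have [->|/set0P[y0 Ky0]] := eqVneq K set0; first by exists 0; rewrite image_set0 => z [].
  have := @compact_EVT_max _ _ f0 K; move=> /(_ _ _ _)/= H.
  have [|||y Ky yM] := H => //; first by exists y0.
    apply/subspace_continuousP => y Ky; apply: cvg_within_filter.
    by apply: cvg_norm; exact: cf.
  by exists (f0 y) => _ [z Kz <-]; apply: yM; rewrite inE.
apply/cvgrPdist_le => e e0.
have := compact_joint_cvg FF e0 cK (cf u0) (fun y Ky => cu c w y (sK y Ky)).
apply: filterS => t ht; apply: sup_dist => //; first exact: ltW.
move=> y Ky; rewrite /f /f0; apply: le_trans (ler_dist_dist _ _) _.
have E (p q r : R) : (p - q) - (r - q) = p - r by ring.
rewrite (Csurf_iterD_sub u0 a _ (sK _ Ky)) (Csurf_iterD_sub (u t) a _ (sK _ Ky)).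
rewrite -[leLHS]/(@Num.norm _ R ((_ - _ : R) - (_ - _))) E distrC; exact: ht.
Qed.

Lemma Csurf_cvg_eval T (F : set_system T) (FF : Filter F) (u : T -> Csurf S) (u0 : Csurf S) x :
  (forall x, S x -> exists c : chart S, chart_cod c x) -> S x ->
  u @ F --> u0 -> (fun t => u t x) @ F --> (u0 x : R).
Proof.
move=> hS Sx; have [c cx] := hS x Sx; have [dx ex] := chart_invK cx Sx.
move=> /(seminorm_cvgP (@Csurf_seminorm R S)) cu.
(* For a single point and the empty word, the seminorm is the absolute value at x. *)
pose i := @CsurfIndex R S c [set chart_inv c x] [::] (@compact_set1 _ (chart_inv c x))
  (fun y => (fun e : y = chart_inv c x => ecast z (chart_dom c z) (esym e) dx)).
have E (v : Csurf S) : Csurf_seminorm i v = `|v x|.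
  by rewrite /Csurf_seminorm /= image_set1 sup1 ex.
have := cu i u0; under eq_fun do rewrite E; rewrite E subrr normr0.
move=> h; apply/cvgrPdist_lt => e e0; have := cvgr0_norm_lt _ h e e0.
by move=> /(_ FF); apply: filterS => t; rewrite normr_id Csurf_subE distrC.
Qed.

(** Evaluations at points of S are continuous and separate [Csurf]. Uniqueness is what determines
    the limit selected by [gateaux]. *)
Lemma Csurf_cvg_unique T (F : set_system T) (FF : ProperFilter F) (u : T -> Csurf S)
    (u0 u1 : Csurf S) :
  (forall x, S x -> exists c : chart S, chart_cod c x) ->
  u @ F --> u0 -> u @ F --> u1 -> u0 = u1.
Proof.
move=> hS c0 c1; apply: Csurf_eq => x Sx.
have e0 := Csurf_cvg_eval FF hS Sx c0; have e1 := Csurf_cvg_eval FF hS Sx c1.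
exact: etrans (esym (cvg_lim (@Rhausdorff R) e0)) (cvg_lim (@Rhausdorff R) e1).
Qed.

End SurfaceConvergence.

(** * Bounded smooth maps *)

Section EuclideanNorm.
Variables (R : realType) (n : nat).
Implicit Types u v : 'rV[R]_n.

Lemma dotC u v : dot u v = dot v u.
Proof. by apply: eq_bigr => i _; rewrite mulrC. Qed.

Lemma dotDl u u' v : dot (u + u') v = dot u v + dot u' v.
Proof. by rewrite -big_split; apply: eq_bigr => i _; rewrite mxE mulrDl. Qed.

Lemma dotZl (a : R) u v : dot (a *: u) v = a * dot u v.
Proof. by rewrite [RHS]big_distrr; apply: eq_bigr => i _; rewrite mxE -mulrA. Qed.

Lemma dotDr u v v' : dot u (v + v') = dot u v + dot u v'.
Proof. by rewrite !(dotC u) dotDl. Qed.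

Lemma dotZr (a : R) u v : dot u (a *: v) = a * dot u v.
Proof. by rewrite !(dotC u) dotZl. Qed.

Lemma enorm_ge0 u : 0 <= enorm u. Proof. exact: sqrtr_ge0. Qed.

Lemma sqr_enorm u : enorm u ^+ 2 = dot u u.
Proof. by rewrite sqr_sqrtr// dot_ge0. Qed.

Lemma dot_eq0 u : dot u u = 0 -> u = 0.
Proof.
move=> /eqP; rewrite psumr_eq0 => [/allP u0|i _]; last by rewrite -expr2 sqr_ge0.
apply/rowP => i; rewrite mxE; apply/eqP.
by have := u0 i (mem_index_enum i); rewrite mulf_eq0 orbb.
Qed.

Lemma dot_gt0 u : u != 0 -> 0 < dot u u.
Proof. by move=> u0; rewrite lt0r dot_ge0 andbT; apply: contraNN u0 => /eqP/dot_eq0->. Qed.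

Lemma cauchy_schwarz u v : dot u v ^+ 2 <= dot u u * dot v v.
Proof.
have [->|v0] := eqVneq v 0.
  by rewrite -(scale0r 0) !dotZr !mul0r expr0n mulr0.
have vv := dot_gt0 v0.
have := dot_ge0 (dot v v *: u - dot u v *: v).
rewrite -scaleN1r scalerA !(dotDl, dotDr, dotZl, dotZr) (dotC v u).
rewrite (_ : _ + _ = dot v v * (dot u u * dot v v - dot u v ^+ 2)); last by ring.
by rewrite pmulr_rge0// subr_ge0.
Qed.

(** The sharp constant makes [Cb_seminorm] subadditive, which the continuity of the seminorms along
    lines relies on. *)
Lemma enormD u v : enorm (u + v) <= enorm u + enorm v.
Proof.
have uv0 : 0 <= enorm u + enorm v by rewrite addr_ge0 ?enorm_ge0.
rewrite -(ler_pXn2r (n := 2))// ?nnegrE ?enorm_ge0// sqr_enorm.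
rewrite dotDl !dotDr (dotC v u) sqrrD !sqr_enorm.
suff : dot u v <= enorm u * enorm v by lra.
apply: le_trans (ler_norm _) _.
rewrite -(ler_pXn2r (n := 2))// ?nnegrE ?mulr_ge0 ?enorm_ge0//.
by rewrite exprMn !sqr_enorm real_normK ?num_real ?cauchy_schwarz.
Qed.

Lemma enorm_entry u i : `|u ord0 i| <= enorm u.
Proof.
rewrite -sqrtr_sqr ler_sqrt ?dot_ge0// /dot (bigD1 i)//= expr2 lerDl.
by apply: sumr_ge0 => j _; rewrite -expr2 sqr_ge0.
Qed.

Lemma enorm_delta i : enorm (delta_mx ord0 i : 'rV[R]_n) = 1.
Proof.
rewrite /enorm /dot (bigD1 i)//= big1 => [|j ji]; last first.
  by rewrite !mxE (negPf ji) mulr0.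
by rewrite !mxE !eqxx mulr1 addr0 sqrtr1.
Qed.

End EuclideanNorm.

Section CbSpace.
Variable R : realType.
Local Notation V := 'rV[R]_3.
Implicit Types (r s xi : Cb R).

(** Flattens the nested suprema of [Cb_seminorm], over orders and over directions, into one
    condition on words. *)
Definition unit_word k (vs : seq V) := (size vs <= k)%N /\ {in vs, forall v, enorm v <= 1}.

Lemma Cb_smooth r : smooth_on setT r.
Proof. by case: r => r /= /asboolP[]. Qed.

Lemma Cb_bound k r : exists M, forall vs x, unit_word k vs -> enorm (iterD vs r x) <= M.
Proof.
case: r => r /= /asboolP[_ rM]; elim: k => [|k [M IH]].
  have [M rM0] := rM 0%N; exists M => vs x [vs0 vs1]; apply: rM0; split=> //.
  by apply/eqP; rewrite -leqn0.
have [N rN] := rM k.+1; exists (Num.max M N) => vs x [vsk vs1].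
rewrite le_max; move: vsk; rewrite leq_eqVlt ltnS => /orP[/eqP vsk|vsk].
  by apply/orP; right; exact: rN.
by apply/orP; left; apply: IH.
Qed.

Lemma Cb_seminorm_ub k r vs x : unit_word k vs -> enorm (iterD vs r x) <= Cb_seminorm k r.
Proof.
have [M rM] := Cb_bound k r; move=> [vsk vs1].
have rM' p y z : (p <= k)%N ->
    [set enorm (iterD ws r y) | ws in unit_directions p] z -> z <= M.
  by move=> pk [ws [wsp ws1] <-]; apply: rM; split=> //; rewrite wsp.
have der_le p y : (p <= k)%N -> der_norm p r y <= M.
  move=> pk; apply: ge_sup => [|z]; last exact: rM'.
  (* The zero word of length p shows that the set under the supremum is nonempty. *)
  exists (enorm (iterD (nseq p 0) r y)), (nseq p 0) => //; split; first by rewrite size_nseq.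
  move=> v /nseqP[-> _]; by rewrite -(scale0r 0) enormZ normr0 mul0r.
apply: (@le_trans _ _ (der_norm (size vs) r x)).
  by apply: ub_le_sup; [exists M => z; exact: rM'|exists vs].
apply: ub_le_sup; last by exists (size vs) => //; exists x.
by exists M => _ [p pk [y _ <-]]; exact: der_le.
Qed.

Lemma Cb_seminorm_le k r (M : R) :
  (forall vs x, unit_word k vs -> enorm (iterD vs r x) <= M) -> Cb_seminorm k r <= M.
Proof.
move=> rM; apply: ge_sup; first by exists (der_norm 0 r 0), 0%N => //; exists 0.
move=> _ [p pk [y _ <-]]; apply: ge_sup => [|_ [ws [wsp ws1] <-]].
  exists (enorm (iterD (nseq p 0) r y)), (nseq p 0) => //; split; first by rewrite size_nseq.
  move=> v /nseqP[-> _]; by rewrite -(scale0r 0) enormZ normr0 mul0r.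
by apply: rM; split=> //; rewrite wsp.
Qed.

Lemma iterD_Cb_lin (a : R) r s vs x :
  iterD vs (a *: r + s : Cb R) x = a *: iterD vs r x + iterD vs s x.
Proof. exact: (iterDP a openT (@Cb_smooth r) (@Cb_smooth s)). Qed.

Lemma Cb_seminorm_lin k (a : R) r s :
  Cb_seminorm k (a *: r + s) <= `|a| * Cb_seminorm k r + Cb_seminorm k s.
Proof.
apply: Cb_seminorm_le => vs x vs1; rewrite iterD_Cb_lin.
apply: le_trans (enormD _ _) _; rewrite enormZ; apply: lerD; last exact: Cb_seminorm_ub.
by apply: ler_wpM2l => //; exact: Cb_seminorm_ub.
Qed.

Lemma Cb_seminorm_ge0 k r : 0 <= Cb_seminorm k r.
Proof.
by apply: le_trans (enorm_ge0 (iterD [::] r 0)) _; apply: Cb_seminorm_ub; split.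
Qed.

Lemma Cb_cvg_seminorm T (F : set_system T) (FF : Filter F) (r : T -> Cb R) r0 k e :
  r @ F --> r0 -> 0 < e -> \forall t \near F, Cb_seminorm k (r t - r0) < e.
Proof.
move=> /(seminorm_cvgP (@Cb_seminorm R))/(_ k r0) + e0.
have -> : Cb_seminorm k (r0 - r0) = 0.
  apply/eqP; rewrite eq_le Cb_seminorm_ge0 andbT subrr -(addr0 0) -{1}(scale0r 0).
  apply: le_trans (Cb_seminorm_lin _ _ _ _) _; rewrite normr0 mul0r add0r.
  apply: Cb_seminorm_le => vs x _; rewrite (_ : iterD vs _ x = 0).
    by rewrite -(scale0r 0) enormZ normr0 mul0r.
  by have := iterD_Cb_lin (-1) 0 0 vs x; rewrite scaleN1r oppr0 addr0 scaleN1r addNr.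
move=> /cvgr0_norm_lt/(_ _ e0); apply: filterS => t.
by rewrite ger0_norm ?Cb_seminorm_ge0.
Qed.

Lemma Cb_cvg_line r xi : (fun t : R => r + t *: xi) @ 0^' --> r.
Proof.
apply/(seminorm_cvgP (@Cb_seminorm R)) => k a; apply/cvgrPdist_le => e e0.
have C0 := Cb_seminorm_ge0 k xi.
have : \forall t \near (0 : R)^', `|t| < e / (Cb_seminorm k xi + 1).
  by apply: dnbhs0_lt; rewrite divr_gt0// ltr_wpDl.
apply: filterS => t; rewrite ltr_pdivlMr; last by rewrite ltr_wpDl.
move=> te; rewrite ler_distl.
(* Subadditivity is used twice, adding [t *: xi] and taking it away, for the two sides of the
   estimate. *)
have h1 := Cb_seminorm_lin k t xi (r - a).
have h2 := Cb_seminorm_lin k (- t) xi (r + t *: xi - a).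
rewrite [_ + (_ - a)]addrC scaleNr addrAC addrK in h2.
have t0 := normr_ge0 t; rewrite mulrDr mulr1 in te.
move: h1 h2 te; rewrite normrN addrA [_ *: _ + r]addrC => h1 h2 te.
suff H (x y q z e' : R) : 0 <= z -> x <= q + y -> y <= q + x -> q + z < e' ->
    x - e' <= y <= x + e' by exact: (H _ _ _ _ _ t0 h1 h2 te).
by clear; lra.
Qed.

End CbSpace.

(** * The metric ball along lines *)

Section Distance.
Variable R : realType.
Implicit Types (r s xi : Cb R).

Let damp (x : R) := x / (1 + x).

Lemma damp_le1 x : 0 <= x -> damp x <= 1.
Proof. by move=> x0; rewrite /damp ler_pdivrMr ?mul1r ?lerDr ?ltr_pwDl. Qed.

Lemma damp_ge0 x : 0 <= x -> 0 <= damp x.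
Proof. by move=> x0; rewrite divr_ge0 ?addr_ge0. Qed.

Lemma damp_le_add x y z : 0 <= x -> 0 <= y -> 0 <= z -> x <= y + z ->
  damp x <= damp y + z.
Proof.
move=> x0 y0 z0 xyz; rewrite /damp ler_pdivrMr ?ltr_pwDl//.
have d : y / (1 + y) * (1 + y) = y by rewrite divfK// gt_eqF// ltr_pwDl.
(* Since y (1 - w) = w, multiplying x <= y + z by 1 - w >= 0 gives x <= w + z + w x, which is
   enough. *)
have := damp_ge0 y0; have := damp_le1 y0; rewrite /damp; set w := y / (1 + y) in d *.
nra.
Qed.

Let term r k : R := 2 ^- k * damp (Cb_seminorm k (0 - r)).

Let term_ge0 r k : 0 <= term r k.
Proof. by rewrite mulr_ge0 ?invr_ge0 ?exprn_ge0 ?damp_ge0 ?Cb_seminorm_ge0. Qed.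

Lemma geometric_tail_le N n :
  \sum_(0 <= k < n) (if (N <= k)%N then 2 ^- k else 0 : R) <= 2 * 2 ^- N.
Proof.
(* Adding the rest of the geometric series, which starts at [maxn N n], makes the bound
   inductive. *)
suff : \sum_(0 <= k < n) (if (N <= k)%N then 2 ^- k else 0 : R) +
    2 * 2 ^- (maxn N n) <= 2 * 2 ^- N.
  by apply: le_trans; rewrite lerDl mulr_ge0 ?invr_ge0 ?exprn_ge0.
elim: n => [|n IH]; first by rewrite big_geq// maxn0 add0r.
rewrite big_nat_recr//=; apply: le_trans IH; rewrite -addrA lerD2l.
case: leqP => [Nn|nN]; last by rewrite add0r (maxn_idPl nN).
rewrite (maxn_idPr (leqW Nn)) exprS invfM mulrA divff ?pnatr_eq0//.
by rewrite mul1r -[in leLHS](mul1r (2 ^- n)) -mulrDl.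
Qed.

(** The bound 1 serves for the tail of the series, uniformly in t; the bound linear in t serves for
    its finitely many first terms. *)
Lemma term_le_add r xi (t : R) k :
  term (r + t *: xi) k <=
  term r k + 2 ^- k * Num.min 1 (`|t| * Cb_seminorm k xi).
Proof.
rewrite -mulrDr ler_pM2l ?invr_gt0 ?exprn_gt0//; rewrite minEle; case: ifP => _.
  by apply: le_trans (damp_le1 (Cb_seminorm_ge0 _ _)) _; rewrite lerDr damp_ge0 ?Cb_seminorm_ge0.
apply: damp_le_add; rewrite ?Cb_seminorm_ge0 ?mulr_ge0 ?Cb_seminorm_ge0//.
rewrite !sub0r opprD -scaleNr addrC [leRHS]addrC -[`|t|]normrN.
exact: Cb_seminorm_lin.
Qed.

Let cvg_term r : cvgn (series (term r)).
Proof.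
apply: nondecreasing_is_cvgn.
  by apply: nondecreasing_series => k _ _; exact: term_ge0.
exists 2 => _ [n _ <-]; rewrite /series /=.
apply: le_trans (_ : 2 * 2 ^- 0 <= 2); last by rewrite expr0 invr1 mulr1.
apply: le_trans (geometric_tail_le 0 n); apply: ler_sum => k _ /=.
by rewrite ler_piMr ?invr_ge0 ?exprn_ge0 ?damp_le1 ?Cb_seminorm_ge0.
Qed.

Lemma Binfty_line e r xi : Binfty e r -> \forall t \near (0 : R), Binfty e (r + t *: xi).
Proof.
have BE s : Binfty e s = (limn (series (term s)) < e) by [].
rewrite BE => re; set d := limn (series (term r)) in re.
(* One third is spent on the tail after N, one third on the first N terms, and the last keeps the
   inequality strict in the limit. *)
pose eps := (e - d) / 3; have eps0 : 0 < eps by rewrite divr_gt0 ?subr_gt0.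
have [N NP] : exists N, 2 * 2 ^- N <= eps.
  have := @cvg_geometric R 2 2^-1; rewrite ger0_norm ?invr_ge0// => h.
  have {}h := h ltac:(lra).
  have /cvgr0_norm_le/(_ _ eps0) := h; case=> N _ /(_ N (leqnn N)) /= hN.
  by exists N; rewrite -exprVn; apply: le_trans hN; exact: ler_norm.
pose C := \sum_(0 <= k < N) Cb_seminorm k xi + 1.
have C0 : 0 < C by rewrite ltr_wpDl// sumr_ge0// => k _; exact: Cb_seminorm_ge0.
have : \forall t \near (0 : R), `|t| < eps / C.
  by apply: nbhs0_lt; rewrite divr_gt0.
apply: filterS => t te; rewrite BE.
have tC : `|t| * C < eps by rewrite -ltr_pdivlMr.
apply: (@le_lt_trans _ _ (d + eps + eps)); last by rewrite /eps; lra.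
apply: limr_le; first exact: cvg_term.
near=> n; rewrite /series /=.
have : \sum_(0 <= k < n) term r k <= d.
  apply: (nondecreasing_cvgn_le (u_ := series (term r))) => //.
  by apply: nondecreasing_series => k _ _; exact: term_ge0.
move=> dn; apply: (@le_trans _ _ (\sum_(0 <= k < n) term r k +
   \sum_(0 <= k < n) ((if (N <= k)%N then 0 else `|t| * Cb_seminorm k xi) +
     (if (N <= k)%N then 2 ^- k else 0)))).
  rewrite -big_split; apply: ler_sum => k _ /=.
  apply: le_trans (term_le_add _ _ _ _) _; rewrite lerD2l.
  case: ifP => _; first by rewrite add0r ler_piMr ?invr_ge0 ?exprn_ge0// ge_min lexx.
  rewrite addr0 -[leRHS]mul1r; apply: ler_pM; rewrite ?invr_ge0 ?exprn_ge0//.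
  - by rewrite le_min ler01 mulr_ge0 ?Cb_seminorm_ge0.
  - by rewrite invf_le1 ?exprn_gt0// exprn_ege1// ler1n.
  - by rewrite ge_min lexx orbT.
rewrite -addrA big_split /=; apply: lerD => //; apply: lerD.
  apply: (@le_trans _ _ (\sum_(0 <= k < N) `|t| * Cb_seminorm k xi)); last first.
    rewrite -big_distrr /=; apply: le_trans (ltW tC).
    by apply: ler_wpM2l => //; rewrite lerDl.
  have [nN|Nn] := leqP n N.
    rewrite [leRHS](big_cat_nat (n := n))//= [leLHS]big_nat_cond [X in _ <= X + _]big_nat_cond.
    rewrite -[leLHS]addr0; apply: lerD; last first.
      by apply: sumr_ge0 => k _; rewrite mulr_ge0 ?Cb_seminorm_ge0.
    by apply: ler_sum => k _; case: ifP => // _; rewrite mulr_ge0 ?Cb_seminorm_ge0.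
  rewrite (big_cat_nat (n := N))//=; last exact: ltnW.
  rewrite -[leRHS]addr0; apply: lerD.
    by apply: ler_sum => k _; case: ifP => // _; rewrite mulr_ge0 ?Cb_seminorm_ge0.
  by rewrite big_nat_cond big1// => k /andP[/andP[-> _] _].
by apply: le_trans (geometric_tail_le N n) NP.
Unshelve. all: by end_near.
Qed.

Lemma Binfty_seminorm_eq e r s :
  (forall k, Cb_seminorm k (0 - s) = Cb_seminorm k (0 - r)) -> Binfty e r -> Binfty e s.
Proof.
move=> rs; have BE z : Binfty e z = (limn (series (term z)) < e) by [].
have E : term s = term r by apply/funext => k; rewrite /term rs.
by rewrite (BE s) (BE r) E.
Qed.

End Distance.

(** * Gateaux derivatives of maps built from first partial derivatives *)

Lemma cvg_eq_near T (Y : topologicalType) (F : set_system T) (FF : Filter F)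
    (f g : T -> Y) (l : Y) :
  (\forall t \near F, f t = g t) -> f @ F --> l -> g @ F --> l.
Proof. by move=> fg; apply: cvg_trans; apply: near_eq_cvg. Qed.

Section Expressions.
Variables (R : realType) (S : set 'rV[R]_3) (U : set (Cb R)).
Local Notation V := 'rV[R]_3.
Hypothesis hS : forall x, S x -> exists c : chart S, chart_cod c x.
Hypothesis U_line : forall r xi, U r -> \forall t \near (0 : R), U (r + t *: xi).
Implicit Types (r xi : Cb R) (c : chart S).

(** A syntax rather than a class of maps: the derivative becomes a function on expressions, and the
    limit theorems are inductions on them. Only r is variable; a direction xi appears as a
    coefficient in [ECst]. *)
Inductive expr :=
| ECst of V -> R
| ELin of 'I_3 & 'I_3
| EAdd of expr & expr
| EMul of expr & expr
| EInv of expr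
| ESqrt of expr.

Definition partial r (i j : 'I_3) (x : V) : R := 'D_(delta_mx ord0 j) r x ord0 i.

Fixpoint eval e r (x : V) : R :=
  match e with
  | ECst g => g x
  | ELin i j => partial r i j x
  | EAdd a b => eval a r x + eval b r x
  | EMul a b => eval a r x * eval b r x
  | EInv a => (eval a r x)^-1
  | ESqrt a => Num.sqrt (eval a r x)
  end.

Fixpoint deriv e xi : expr :=
  match e with
  | ECst g => ECst (fun=> 0)
  | ELin i j => ECst (partial xi i j)
  | EAdd a b => EAdd (deriv a xi) (deriv b xi)
  | EMul a b => EAdd (EMul (deriv a xi) b) (EMul a (deriv b xi))
  | EInv a => EMul (EMul (ECst (fun=> -1)) (EMul (EInv a) (EInv a))) (deriv a xi)
  | ESqrt a => EMul (EMul (ECst (fun=> 2^-1)) (EInv (ESqrt a))) (deriv a xi)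
  end.

Fixpoint wf e : Prop :=
  match e with
  | ECst g => chart_smooth S g
  | ELin _ _ => True
  | EAdd a b | EMul a b => wf a /\ wf b
  | EInv a => wf a /\ forall r x, U r -> S x -> eval a r x != 0
  | ESqrt a => wf a /\ forall r x, U r -> S x -> 0 < eval a r x
  end.

Lemma partial_lin (a : R) r s i j x :
  partial (a *: r + s : Cb R) i j x = a * partial r i j x + partial s i j x.
Proof.
have := iterD_Cb_lin a r s [:: delta_mx ord0 j] x.
by rewrite /partial /= => ->; rewrite !mxE.
Qed.

Lemma smooth_partial r i j : smooth_on setT (partial r i j).
Proof.
apply: (smooth_on_entry (f := 'D_(delta_mx ord0 j) r)); first exact: openT.
exact/smooth_on_derive/Cb_smooth.
Qed.

Lemma chart_smooth_partial r i j : chart_smooth S (partial r i j).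
Proof.
move=> c; apply: (smooth_on_comp _ _ (smooth_partial r i j)) => //.
  exact: chart_dom_open.
exact: chart_map_smooth.
Qed.

Lemma iterD_partial r i j vs x :
  iterD vs (partial r i j) x = iterD (rcons vs (delta_mx ord0 j)) r x ord0 i.
Proof.
rewrite iterD_rcons (iterD_entry i _ openT)//.
exact/smooth_on_derive/Cb_smooth.
Qed.

Lemma deriv_lin e (a : R) xi eta r x :
  eval (deriv e (a *: xi + eta)) r x =
  a * eval (deriv e xi) r x + eval (deriv e eta) r x.
Proof.
elim: e => [g|i j|b IHb c IHc|b IHb c IHc|b IHb|b IHb] /=.
- by rewrite mulr0 addr0.
- exact: partial_lin.
- by rewrite IHb IHc; ring.
- by rewrite IHb IHc; ring.
- by rewrite IHb; ring.
- by rewrite IHb; ring.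
Qed.

Lemma wf_deriv e xi : wf e -> wf (deriv e xi).
Proof.
elim: e => [g|i j|b IHb c IHc|b IHb c IHc|b IHb|b IHb] /=.
- by move=> _ c; exact: smooth_on_cst.
- by move=> _; exact: chart_smooth_partial.
- by move=> [/IHb wb /IHc wc].
- by move=> [wb wc]; split; split=> //; [exact: IHb|exact: IHc].
- move=> [wb b0]; split; last exact: IHb.
  by split=> // c; exact: smooth_on_cst.
- move=> [wb b0]; split; last exact: IHb.
  split; first by move=> c; exact: smooth_on_cst.
  by split=> // r x Ur Sx; rewrite gt_eqF// sqrtr_gt0 b0.
Qed.

Section Limits.
Variables (T : Type) (F : set_system T).
Context {FF : Filter F}.
Variable c : chart S.
Local Notation D := (chart_dom c).
Let oD : open D := @chart_dom_open _ _ c.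

Lemma SmoothCvg_partial (r : T -> Cb R) r0 i j : r @ F --> r0 ->
  SmoothCvg F D (fun t => partial (r t) i j \o chart_map c) (partial r0 i j \o chart_map c).
Proof.
move=> rr0; apply: (@SmoothCvg_comp _ _ _ _ _ _ setT (fun t => partial (r t) i j)) => //.
- exact: chart_map_smooth.
- by apply: nearW => t; exact: smooth_partial.
- exact: smooth_partial.
move=> w z _; apply/cvgrPdist_lt => e e0.
have e2 : 0 < e / 2 by rewrite divr_gt0.
(* The order is one more than the length of w because [partial] is itself a first derivative. *)
have cr := Cb_cvg_seminorm FF (size w).+1 rr0 e2.
have cz : \forall y \near z, `|iterD (word R w) (partial r0 i j) z -
    iterD (word R w) (partial r0 i j) y| < e / 2.
  have /differentiable_continuous := @smooth_partial r0 i j (word R w) z I.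
  by move=> /cvgrPdist_lt; apply.
exists ([set t | Cb_seminorm (size w).+1 (r t - r0) < e / 2],
  [set y | `|iterD (word R w) (partial r0 i j) z -
     iterD (word R w) (partial r0 i j) y| < e / 2]) => //.
move=> [t y] /= [ht hy].
(* The first part is small by continuity of the limit at z, the second by uniform convergence on the
   whole space. *)
rewrite (_ : _ - _ = (iterD (word R w) (partial r0 i j) z - iterD (word R w) (partial r0 i j) y)
   - iterD (word R w) (partial (r t - r0 : Cb R) i j) y).
  apply: le_lt_trans (ler_normB _ _) _; rewrite [ltRHS]splitr; apply: ltrD => //.
  apply: le_lt_trans ht; rewrite iterD_partial.
  apply: le_trans (enorm_entry _ _) _; apply: Cb_seminorm_ub; split.
    by rewrite size_rcons size_map.
  move=> v; rewrite mem_rcons inE => /orP[/eqP->|/mapP[k _ ->]];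
    by rewrite enorm_delta.
have := iterD_Cb_lin (-1) r0 (r t) (rcons (word R w) (delta_mx ord0 j)) y.
rewrite !iterD_partial scaleN1r [- r0 + _]addrC => ->.
rewrite !mxE; ring.
Qed.

Lemma SmoothCvg_chart_smooth g : chart_smooth S g ->
  SmoothCvg F D (fun=> g \o chart_map c) (g \o chart_map c).
Proof. by move=> sg; exact/SmoothCvg_cst/sg. Qed.

Lemma SmoothCvg_eval e (r : T -> Cb R) r0 : wf e -> r @ F --> r0 ->
  U r0 -> (\forall t \near F, U (r t)) ->
  SmoothCvg F D (fun t => eval e (r t) \o chart_map c) (eval e r0 \o chart_map c).
Proof.
move=> + rr0 U0 Ur; have S_ y : D y -> S (chart_map c y) by exact: chart_dom_chart_map.
elim: e => [g|i j|a IHa b IHb|a IHa b IHb|a IHa|a IHa] /=.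
- exact: SmoothCvg_chart_smooth.
- by move=> _; exact: SmoothCvg_partial.
- by move=> [/IHa Fa /IHb Fb]; exact: SmoothCvg_add Fa Fb.
- by move=> [/IHa Fa /IHb Fb]; exact: SmoothCvg_mul Fa Fb.
- move=> [/IHa Fa a0]; apply: (SmoothCvg_inv Fa).
    by apply: filterS Ur => t Ut y /S_; exact: a0.
  by move=> y /S_; exact: a0.
- move=> [/IHa Fa a0]; apply: (SmoothCvg_sqrt Fa).
    by apply: filterS Ur => t Ut y /S_; exact: a0.
  by move=> y /S_; exact: a0.
Qed.

(** Joint continuity in (r, xi) lets the direction move as well, so the expression [deriv e (xi t)]
    itself changes with t and [SmoothCvg_eval] does not cover it. *)
Lemma SmoothCvg_deriv e (r xi : T -> Cb R) r0 xi0 : wf e -> r @ F --> r0 -> xi @ F --> xi0 ->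
  U r0 -> (\forall t \near F, U (r t)) ->
  SmoothCvg F D (fun t => eval (deriv e (xi t)) (r t) \o chart_map c)
          (eval (deriv e xi0) r0 \o chart_map c).
Proof.
move=> + rr0 xx0 U0 Ur.
elim: e => [g|i j|a IHa b IHb|a IHa b IHb|a IHa|a IHa] /=.
- by move=> _; exact/SmoothCvg_cst/smooth_on_cst.
- by move=> _; exact: SmoothCvg_partial.
- by move=> [/IHa Fa /IHb Fb]; exact: SmoothCvg_add Fa Fb.
- move=> [wa wb]; have Ea := SmoothCvg_eval wa rr0 U0 Ur; have Eb := SmoothCvg_eval wb rr0 U0 Ur.
  exact: SmoothCvg_add (SmoothCvg_mul (IHa wa) Eb) (SmoothCvg_mul Ea (IHb wb)).
- move=> [wa a0]; have Ea := @SmoothCvg_eval (EInv a) _ _ (conj wa a0) rr0 U0 Ur.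
  have Fc := SmoothCvg_mul (SmoothCvg_cst F (smooth_on_cst (-1))) (SmoothCvg_mul Ea Ea).
  exact: (SmoothCvg_mul Fc (IHa wa)).
(* That the root does not vanish is read off the well-formedness of the derivative, in the arbitrary
   direction 0. *)
- move=> [wa a0]; have [[_ ws] _] := @wf_deriv (ESqrt a) 0 (conj wa a0).
  have Ea := @SmoothCvg_eval (EInv (ESqrt a)) _ _ ws rr0 U0 Ur.
  exact: (SmoothCvg_mul (SmoothCvg_mul (SmoothCvg_cst F (smooth_on_cst 2^-1)) Ea) (IHa wa)).
Qed.

End Limits.

Lemma eval_smooth e r : wf e -> U r -> chart_smooth S (eval e r).
Proof.
move=> we Ur c; have cc : (fun=> r) @ globally [set: unit] --> r by exact: cvg_cst.
have Uc : \forall t \near globally [set: unit], U r by exact: nearW.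
exact: (SmoothCvg_smooth (@chart_dom_open _ _ c) (SmoothCvg_eval c we cc Ur Uc)).
Qed.

Lemma near0_U r xi : U r -> \forall t \near (0 : R)^', U (r + t *: xi).
Proof. by move=> Ur; apply: nbhs_dnbhs; exact: U_line. Qed.

(** Let q be the quotient of increments and a_t the value of a at r + t xi. The exact identities
    q(ab) = q(a) b_t + a q(b), q(1/a) = - q(a) / (a a_t) and q(sqrt a) = q(a) / (sqrt a_t + sqrt a)
    reduce each case to closure rules. *)
Lemma SmoothCvg_quotient c e r xi : wf e -> U r ->
  SmoothCvg (0 : R)^' (chart_dom c)
    (fun t => (fun x => t^-1 * (eval e (r + t *: xi) x - eval e r x)) \o chart_map c)
    (eval (deriv e xi) r \o chart_map c).
Proof.
move=> + Ur; have Ut := near0_U xi Ur; have rt := @Cb_cvg_line R r xi.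
have n0 : \forall t \near (0 : R)^', t != 0 by exact: nbhs_dnbhs_neq.
have S_ y : chart_dom c y -> S (chart_map c y) by exact: chart_dom_chart_map.
have cst e1 : wf e1 -> SmoothCvg (0 : R)^' (chart_dom c) (fun=> eval e1 r \o chart_map c)
    (eval e1 r \o chart_map c) by move=> we; apply/SmoothCvg_cst/eval_smooth.
elim: e => [g|i j|a IHa b IHb|a IHa b IHb|a IHa|a IHa] /=.
- move=> _; apply: (SmoothCvg_eq (SmoothCvg_cst _ (smooth_on_cst 0))) => //.
  by apply: nearW => t y _ /=; rewrite subrr mulr0.
- move=> _; apply: (SmoothCvg_eq (SmoothCvg_cst _ (chart_smooth_partial xi i j (c := c)))) => //.
  apply: filterS n0 => t t0 y _ /=.
  have := partial_lin t xi r i j (chart_map c y); rewrite [t *: xi + r]addrC => ->.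
  by rewrite addrK mulrA mulVf// mul1r.
- move=> [/IHa Fa /IHb Fb]; apply: (SmoothCvg_eq (SmoothCvg_add Fa Fb)) => //.
  by apply: nearW => t y _ /=; ring.
- move=> [wa wb]; have Fb := @SmoothCvg_eval _ _ (dnbhs_filter _) c b _ _ wb rt Ur Ut.
  have Fab := SmoothCvg_add (SmoothCvg_mul (IHa wa) Fb) (SmoothCvg_mul (cst _ wa) (IHb wb)).
  apply: (SmoothCvg_eq Fab) => //.
  by apply: nearW => t y _ /=; ring.
- move=> [wa a0].
  have Fi := @SmoothCvg_eval _ _ (dnbhs_filter _) c (EInv a) _ _ (conj wa a0) rt Ur Ut.
  have Fi0 := cst (EInv a) (conj wa a0).
  have Fc := SmoothCvg_mul (SmoothCvg_cst _ (smooth_on_cst (-1))) (SmoothCvg_mul Fi0 Fi).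
  apply: (SmoothCvg_eq (SmoothCvg_mul Fc (IHa wa))) => //.
  apply: filterS Ut => t Ut y /S_ Sy /=.
  by move: (t^-1) (a0 _ _ Ut Sy) (a0 _ _ Ur Sy) => q p1 p0; field; rewrite p1 p0.
- move=> [wa a0].
  have Fs := @SmoothCvg_eval _ _ (dnbhs_filter _) c (ESqrt a) _ _ (conj wa a0) rt Ur Ut.
  have Fs0 := cst (ESqrt a) (conj wa a0).
  have s0 t y : U (r + t *: xi) -> chart_dom c y ->
      0 < Num.sqrt (eval a (r + t *: xi) (chart_map c y)) + Num.sqrt (eval a r (chart_map c y)).
    by move=> Ut' /S_ Sy; rewrite addr_gt0// sqrtr_gt0 a0.
  have s1 y : chart_dom c y -> Num.sqrt (eval a r (chart_map c y)) != 0.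
    by move=> /S_ Sy; rewrite gt_eqF// sqrtr_gt0 a0.
  apply: (SmoothCvg_eq (SmoothCvg_mul (SmoothCvg_inv (SmoothCvg_add Fs Fs0) _ _) (IHa wa))).
  + by apply: filterS Ut => t Ut y Dy; rewrite gt_eqF//; exact: s0.
  + by move=> y Dy; rewrite -mulr2n -mulr_natl mulf_neq0 ?pnatr_eq0// s1.
  + apply: filterS Ut => t Ut y Dy /=.
    have := s0 t y Ut Dy; rewrite lt0r => /andP[sn _].
    have p1 := a0 _ _ Ut (S_ _ Dy); have p0 := a0 _ _ Ur (S_ _ Dy).
    rewrite mulrCA; congr (_ * _).
    rewrite -{2}(sqr_sqrtr (ltW p1)) -{2}(sqr_sqrtr (ltW p0)) subr_sqr.
    by rewrite mulrCA mulVf// mulr1.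
  + by move=> y Dy /=; congr (_ * _); rewrite -mulr2n -(mulr_natl (Num.sqrt _)) invfM.
Qed.
Definition to_map e r : Csurf S := to_Csurf S (eval e r).

Lemma to_mapE e r x : wf e -> U r -> S x -> to_map e r x = eval e r x.
Proof. by move=> we Ur; apply: to_CsurfE; exact/(chart_smooth_map hS)/eval_smooth. Qed.

Lemma SmoothCvg_Csurf_cvg T (F : set_system T) (FF : Filter F) (u : T -> Csurf S)
    (u0 : Csurf S) (g : T -> V -> R) (g0 : V -> R) :
  (\forall t \near F, forall x, S x -> g t x = u t x) -> (forall x, S x -> g0 x = u0 x) ->
  (forall c, SmoothCvg F (chart_dom c) (fun t => g t \o chart_map c) (g0 \o chart_map c)) ->
  u @ F --> u0.
Proof.
move=> gu gu0 Fg; apply: Csurf_cvg => c w y Dy.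
have Fu : SmoothCvg F (chart_dom c) (fun t => u t \o chart_map c) (u0 \o chart_map c).
  apply: (SmoothCvg_eq (Fg c)); last by move=> z /chart_dom_chart_map/gu0.
  by apply: filterS gu => t gu z /chart_dom_chart_map/gu.
have oD := @chart_dom_open _ _ c.
exact: (SmoothCvg_joint_cvg oD (SmoothCvg_iterD oD (word R w) Fu)).
Qed.

Lemma to_map_cvg T (F : set_system T) (FF : Filter F) e (r : T -> Cb R) r0 :
  wf e -> r @ F --> r0 -> U r0 -> (\forall t \near F, U (r t)) ->
  (fun t => to_map e (r t)) @ F --> to_map e r0.
Proof.
move=> we rr0 U0 Ur; apply: (@SmoothCvg_Csurf_cvg _ F FF _ _ (fun t => eval e (r t)) (eval e r0));
  [| |by move=> c; exact: SmoothCvg_eval].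
  by apply: filterS Ur => t Ut x Sx; rewrite to_mapE.
by move=> x Sx; rewrite to_mapE.
Qed.

Lemma to_map_deriv_cvg T (F : set_system T) (FF : Filter F) e (r xi : T -> Cb R) r0 xi0 :
  wf e -> r @ F --> r0 -> xi @ F --> xi0 -> U r0 -> (\forall t \near F, U (r t)) ->
  (fun t => to_map (deriv e (xi t)) (r t)) @ F --> to_map (deriv e xi0) r0.
Proof.
move=> we rr0 xx0 U0 Ur; apply: (@SmoothCvg_Csurf_cvg _ F FF _ _
  (fun t => eval (deriv e (xi t)) (r t)) (eval (deriv e xi0) r0));
  [| |by move=> c; exact: SmoothCvg_deriv].
  by apply: filterS Ur => t Ut x Sx; rewrite to_mapE//; exact: wf_deriv.
by move=> x Sx; rewrite to_mapE//; exact: wf_deriv.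
Qed.

(** Freezing the point in the joint convergence of quotients gives a scalar limit, so any other
    computation of that limit determines the value of [deriv]. *)
Lemma deriv_limit e r xi x : wf e -> U r -> S x ->
  (fun t => t^-1 * (eval e (r + t *: xi) x - eval e r x)) @ (0 : R)^' -->
  eval (deriv e xi) r x.
Proof.
move=> we Ur Sx; have [c cx] := hS Sx; have [Dy <-] := chart_invK cx Sx.
have := SmoothCvg_joint_cvg (@chart_dom_open _ _ c) (SmoothCvg_quotient c xi we Ur) Dy.
move=> /(_ (dnbhs_filter _)) cq.
pose k (t : R) := (t, chart_inv c x).
have ck : k @ (0 : R)^' --> filter_prod (0 : R)^' (nbhs (chart_inv c x)).
  apply: (@cvg_pair _ _ _ (0 : R)^' (0 : R)^' (nbhs (chart_inv c x)) _ _ _ id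
    (fun=> chart_inv c x)); [exact: cvg_id|exact: cvg_cst].
exact: (@cvg_comp _ _ _ k (fun p : R * 'rV[R]_2 => p.1^-1 *
  (eval e (r + p.1 *: xi) (chart_map c p.2) - eval e r (chart_map c p.2))) _ _ _ ck cq).
Qed.

Section Gateaux.
Variables (f : Cb R -> Csurf S) (e : expr).
Hypotheses (we : wf e) (fe : forall r, U r -> f r = to_map e r).

Lemma gateaux_quotient_cvg r xi : U r ->
  gateaux_quotient f r xi @ 0^' --> to_map (deriv e xi) r.
Proof.
move=> Ur; apply: (@SmoothCvg_Csurf_cvg R 0^' _ _ _
  (fun t x => t^-1 * (eval e (r + t *: xi) x - eval e r x)) (eval (deriv e xi) r));
  [| |by move=> c; exact: SmoothCvg_quotient].
  apply: filterS (near0_U xi Ur) => t Ut x Sx.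
  rewrite /gateaux_quotient Csurf_scaleE Csurf_subE !fe// !to_mapE//.
by move=> x Sx; rewrite to_mapE//; exact: wf_deriv.
Qed.

Lemma gateauxE r xi : U r -> gateaux f r xi = to_map (deriv e xi) r.
Proof.
move=> Ur; rewrite /gateaux; case: xgetP => [l _ cl|/(_ (to_map (deriv e xi) r))]; last first.
  by case; exact: gateaux_quotient_cvg.
have := @Csurf_cvg_unique _ S R 0^' (Proper_dnbhs_numFieldType _)
  (gateaux_quotient f r xi) _ _ hS cl.
by apply; exact: gateaux_quotient_cvg.
Qed.

Lemma gateaux_differentiable_expr r : U r -> gateaux_differentiable f r.
Proof.
move=> Ur; split=> [xi|a xi eta|xi].
- by exists (to_map (deriv e xi) r); exact: gateaux_quotient_cvg.
- rewrite !gateauxE//; apply: Csurf_eq => x Sx.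
  rewrite Csurf_addE Csurf_scaleE !to_mapE//; try exact: wf_deriv.
  exact: deriv_lin.
- rewrite /continuous_at gateauxE// (_ : gateaux f r = fun xi => to_map (deriv e xi) r).
    apply: (@to_map_deriv_cvg _ (nbhs xi) _ e (fun=> r) id r xi) => //; first exact: cvg_cst.
    exact: nearW.
  by apply/funext => z; exact: gateauxE.
Qed.

Lemma gateaux_C1_expr : gateaux_C1 U f.
Proof.
split; first exact: gateaux_differentiable_expr.
apply/subspace_continuousP => -[r xi] [/= Ur _].
rewrite -[X in _ --> X]/(gateaux f r xi). rewrite gateauxE//; set F := within _ _.
have FU : \forall q \near F, U q.1.
  by rewrite /F near_withinE; apply: nearW => -[s eta] [].
have c1 : fst @ F --> r.
  move=> A nA; change (nbhs (r, xi) (fun q => (U `*` [set: Cb R]) q -> A q.1)).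
  have nA' : nbhs (r, xi) (fun q => A q.1).
    exact: (@cvg_fst _ _ (nbhs r) (nbhs xi) (nbhs_filter _) A nA).
  by apply: filterS nA' => q Aq _.
have c2 : snd @ F --> xi.
  move=> A nA; change (nbhs (r, xi) (fun q => (U `*` [set: Cb R]) q -> A q.2)).
  have nA' : nbhs (r, xi) (fun q => A q.2).
    exact: (@cvg_snd _ _ (nbhs r) (nbhs xi) (nbhs_filter _) A nA).
  by apply: filterS nA' => q Aq _.
apply: (cvg_eq_near _ _ (to_map_deriv_cvg _ we c1 c2 Ur FU)).
by apply: filterS FU => -[s eta] /= Us; exact/esym/gateauxE.
Qed.

Lemma continuous_expr : {within U, continuous f}.
Proof.
apply/subspace_continuousP => r Ur; rewrite -[X in _ --> X]/(f r) fe//; set F := within _ _.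
have FU : \forall q \near F, U q by rewrite /F near_withinE; exact: nearW.
have c1 : id @ F --> r by exact: cvg_within.
apply: (cvg_eq_near _ _ (to_map_cvg _ we c1 Ur FU)).
by apply: filterS FU => s Us; exact/esym/fe.
Qed.

End Gateaux.

(** The induction generalizes f and e: the derivative in the first direction, as a map of r, again
    agrees on U with an expression. *)
Lemma gateaux_iter_expr f e xis : wf e -> (forall r, U r -> f r = to_map e r) ->
  exists2 e', wf e' & forall r, U r -> gateaux_iter f xis r = to_map e' r.
Proof.
elim: xis f e => [|xi xis IH] f e we fe /=; first by exists e.
apply: (IH _ (deriv e xi)); first exact: wf_deriv.
by move=> r Ur; exact: gateauxE.
Qed.

Lemma gateaux_Cinfty_expr f e : wf e -> (forall r, U r -> f r = to_map e r) ->
  gateaux_Cinfty U f.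
Proof.
move=> we fe; elim=> [|m IH] /=; first exact: continuous_expr we fe.
split=> // xis; have [e' we' fe'] := gateaux_iter_expr xis we fe.
exact: gateaux_C1_expr we' fe'.
Qed.

End Expressions.

(** * Geometry of a displaced surface *)

Section CrossProduct.
Variable R : realType.
Local Notation V := 'rV[R]_3.
Implicit Types (u v w a b : V) (A : 'M[R]_3).

(** The indices have the form produced by [big_ord_recl]. *)
Let i0 : 'I_3 := ord0.
Let i1 : 'I_3 := lift ord0 ord0.
Let i2 : 'I_3 := lift ord0 (lift ord0 ord0).

Lemma sum3 (W : nmodType) (F : 'I_3 -> W) : \sum_i F i = F i0 + (F i1 + F i2).
Proof. by rewrite !big_ord_recl big_ord0 addr0. Qed.

Lemma ord3P (P : 'I_3 -> Prop) : P i0 -> P i1 -> P i2 -> forall i, P i.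
Proof.
move=> p0 p1 p2 [[|[|[|//]]] h].
- by rewrite (_ : Ordinal h = i0)//; exact: val_inj.
- by rewrite (_ : Ordinal h = i1)//; exact: val_inj.
- by rewrite (_ : Ordinal h = i2)//; exact: val_inj.
Qed.

Definition cross u v : V := \row_k
  [:: u ord0 i1 * v ord0 i2 - u ord0 i2 * v ord0 i1;
      u ord0 i2 * v ord0 i0 - u ord0 i0 * v ord0 i2;
      u ord0 i0 * v ord0 i1 - u ord0 i1 * v ord0 i0]`_k.

Lemma cross0 u v : cross u v ord0 i0 = u ord0 i1 * v ord0 i2 - u ord0 i2 * v ord0 i1.
Proof. by rewrite mxE. Qed.
Lemma cross1 u v : cross u v ord0 i1 = u ord0 i2 * v ord0 i0 - u ord0 i0 * v ord0 i2.
Proof. by rewrite mxE. Qed.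
Lemma cross2 u v : cross u v ord0 i2 = u ord0 i0 * v ord0 i1 - u ord0 i1 * v ord0 i0.
Proof. by rewrite mxE. Qed.

Definition crossE := (cross0, cross1, cross2).

Lemma dot3 u v : dot u v = u ord0 i0 * v ord0 i0 + (u ord0 i1 * v ord0 i1 + u ord0 i2 * v ord0 i2).
Proof. exact: sum3. Qed.

Lemma lagrange u v : dot (cross u v) (cross u v) = dot u u * dot v v - dot u v ^+ 2.
Proof. by rewrite !dot3 !crossE; ring. Qed.

Lemma crossDl u u' v : cross (u + u') v = cross u v + cross u' v.
Proof. by apply/rowP; apply: ord3P; rewrite !(crossE, mxE); ring. Qed.

Lemma crossDr u v v' : cross u (v + v') = cross u v + cross u v'.
Proof. by apply/rowP; apply: ord3P; rewrite !(crossE, mxE); ring. Qed.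

Lemma crossZl (c : R) u v : cross (c *: u) v = c *: cross u v.
Proof. by apply/rowP; apply: ord3P; rewrite !(crossE, mxE); ring. Qed.

Lemma crossZr (c : R) u v : cross u (c *: v) = c *: cross u v.
Proof. by apply/rowP; apply: ord3P; rewrite !(crossE, mxE); ring. Qed.

(** By Lagrange's identity, a vanishing product is the equality case of Cauchy-Schwarz: |a|^2 b =
    (a.b) a. Freeness forces a = 0, which contradicts freeness. *)
Lemma cross_neq0 a b :
  (forall x y : R, x *: a + y *: b = 0 -> x = 0 /\ y = 0) -> cross a b != 0.
Proof.
move=> free; apply/eqP => ab0.
have := lagrange a b; rewrite ab0 -(scale0r 0) dotZl mul0r => /esym/eqP.
rewrite subr_eq0 => /eqP E.
have : dot (dot a a *: b - dot a b *: a) (dot a a *: b - dot a b *: a) = 0.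
  rewrite -scaleN1r scalerA !(dotDl, dotDr, dotZl, dotZr) (dotC b a).
  rewrite (_ : _ + _ = dot a a * (dot a a * dot b b - dot a b ^+ 2)); last by ring.
  by rewrite E subrr mulr0.
move=> /dot_eq0/eqP; rewrite addrC -scaleNr => /eqP/free[_ aa].
have a0 := dot_eq0 aa.
have [] := free 1 0; first by rewrite a0 scaler0 scale0r addr0.
by move=> /eqP; rewrite oner_eq0.
Qed.

(** The product w x (a x b) = (w.b) a - (w.a) b vanishes, so w is parallel to a x b. Only the square
    of the factor s is determined. *)
Lemma unit_normal_cross a b w : cross a b != 0 -> enorm w = 1 -> dot w a = 0 -> dot w b = 0 ->
  exists s, w = s *: cross a b /\ s ^+ 2 * dot (cross a b) (cross a b) = 1.
Proof.
move=> N0 w1 wa wb; have NN := dot_gt0 N0.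
exists (dot w (cross a b) / dot (cross a b) (cross a b)).
have E : dot (cross a b) (cross a b) *: w = dot w (cross a b) *: cross a b.
  have K : cross w (cross a b) = 0.
    have -> : cross w (cross a b) = dot w b *: a - dot w a *: b.
      by apply/rowP; apply: ord3P; rewrite !(crossE, mxE) !dot3; ring.
    by rewrite wa wb !scale0r subrr.
  have := congr1 (cross (cross a b)) K; rewrite -[X in _ = cross _ X](scale0r 0) crossZr scale0r.
  have -> : cross (cross a b) (cross w (cross a b)) =
      dot (cross a b) (cross a b) *: w - dot w (cross a b) *: cross a b.
    move: (cross a b) => N; apply/rowP; apply: ord3P; rewrite !(crossE, mxE) !dot3; ring.
  by move=> /eqP; rewrite subr_eq0 => /eqP.
have wE : w = (dot w (cross a b) / dot (cross a b) (cross a b)) *: cross a b.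
  by rewrite mulrC -scalerA -E scalerA mulVf ?scale1r// gt_eqF.
split=> //.
by have := sqr_enorm w; rewrite w1 expr1n {1 2}wE dotZl dotZr mulrA -expr2.
Qed.

Lemma det22 (M : 'M[R]_2) : \det M = M ord0 ord0 * M (lift ord0 ord0) (lift ord0 ord0)
  - M ord0 (lift ord0 ord0) * M (lift ord0 ord0) ord0.
Proof.
rewrite (expand_det_row _ ord0) !big_ord_recl big_ord0 /cofactor !det_mx11 !mxE.
have -> : lift (lift ord0 ord0 : 'I_2) ord0 = ord0 :> 'I_2 by exact: val_inj.
rewrite expr0 expr1; ring.
Qed.

Lemma det33 A : \det A = A i0 i0 * (A i1 i1 * A i2 i2 - A i1 i2 * A i2 i1)
  - A i0 i1 * (A i1 i0 * A i2 i2 - A i1 i2 * A i2 i0)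
  + A i0 i2 * (A i1 i0 * A i2 i1 - A i1 i1 * A i2 i0).
Proof.
rewrite (expand_det_row _ i0) sum3 /cofactor !det22 !mxE.
have -> : lift i1 ord0 = i0 by exact: val_inj.
have -> : lift i1 (lift ord0 ord0) = i2 by exact: val_inj.
have -> : lift i2 ord0 = i0 by exact: val_inj.
have -> : lift i2 (lift ord0 ord0) = i1 by exact: val_inj.
have -> : lift i0 ord0 = i1 by exact: val_inj.
have -> : lift i0 (lift ord0 ord0) = i2 by exact: val_inj.
rewrite /= expr0 expr1 (_ : (0 + 2)%N = 2%N)// sqrrN expr1n; ring.
Qed.

Lemma mulmx3 u A k : (u *m A) ord0 k =
  u ord0 i0 * A i0 k + (u ord0 i1 * A i1 k + u ord0 i2 * A i2 k).
Proof. by rewrite mxE sum3. Qed.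

(* The cofactor matrix of A maps u x v to (Au) x (Av). *)
Lemma cross_mulmx_tr u v A : \det A != 0 ->
  \det A *: (cross u v *m invmx A) = cross (u *m A^T) (v *m A^T).
Proof.
move=> dA; have uA : A \in unitmx by rewrite unitmxE unitfE.
apply: (can_inj (mulmxK uA)); rewrite -scalemxAl mulmxKV//.
by apply/rowP; apply: ord3P; rewrite mulmx3 !crossE !mulmx3 det33 !(crossE, mxE); ring.
Qed.

(** This is det(aM, b, c) + det(a, bM, c) + det(a, b, cM) = tr M det(a, b, c) for c = a x b. *)
Lemma trace_cross a b (M : 'M[R]_3) :
  dot (cross a b) (cross a b) * \tr M - dot (cross a b *m M) (cross a b) =
  dot (cross (a *m M) b + cross a (b *m M)) (cross a b).
Proof.
by rewrite /mxtrace sum3 !dot3 !(crossE, mxE) !sum3 !crossE; ring.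
Qed.

End CrossProduct.

(** * Tangent vectors and their images under a displacement *)

Section Tangent.
Variable R : realType.
Local Notation V := 'rV[R]_3.
Implicit Types (S : set V) (r : Cb R).

Lemma derive_jacobian m n (f : 'rV[R]_m -> 'rV[R]_n) x v :
  differentiable f x -> 'D_v f x = v *m 'J f x.
Proof. by move=> df; rewrite deriveEjacobian. Qed.

Lemma smooth_displace r : smooth_on setT (displace r).
Proof.
have sid : smooth_on setT (@id V).
  apply: (@smooth_on_ind _ _ _ (fun f => (f = id) \/ exists b : V, f = cst b)); last by left.
    by move=> f [->|[b ->]] x _; [by have [] := @is_diff_id R V x|exact: differentiable_cst].
  move=> f v [->|[b ->]]; right.
    by exists v; apply/funext => x; rewrite derive_id.
  by exists 0; apply/funext => x; rewrite derive_cst.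
have := smooth_onP 1 openT sid (@Cb_smooth _ r).
by rewrite scale1r.
Qed.

Lemma differentiable_displace r x : differentiable (displace r) x.
Proof. exact: (smooth_on_differentiable (smooth_displace r)). Qed.

Lemma derive_displace r x v : 'D_v (displace r) x = v + 'D_v r x.
Proof.
have dr : differentiable r x by apply: (smooth_on_differentiable (@Cb_smooth _ r)).
have -> : displace r = id + (r : V -> V) by [].
rewrite deriveD; [|exact: derivable_id|exact: diff_derivable].
by rewrite derive_id.
Qed.

Lemma derive_displaceE r x v : 'D_v (displace r) x = v *m (1%:M + Dmx r x)^T.
Proof.
rewrite derive_displace linearD/= trmx1 trmxK mulmxDr mulmx1 derive_jacobian//.
exact: (smooth_on_differentiable (@Cb_smooth _ r)).
Qed.

Lemma chart_differentiable S (c : chart S) y : chart_dom c y -> differentiable (chart_map c) y.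
Proof. exact: smooth_on_differentiable (@chart_map_smooth _ _ c). Qed.

Lemma chart_inv_differentiable S (c : chart S) x : chart_cod c x -> differentiable (chart_inv c) x.
Proof. exact: smooth_on_differentiable (@chart_inv_smooth _ _ c). Qed.

Lemma derive_left_inverse m n (f : 'rV[R]_m -> 'rV[R]_n) (g : 'rV[R]_n -> 'rV[R]_m) y v :
  differentiable f y -> differentiable g (f y) ->
  (\forall z \near y, g (f z) = z) -> 'D_v f y = 0 -> v = 0.
Proof.
move=> df dg gf fv; have : 'D_v (g \o f) y = v by rewrite (near_eq_derive v gf) derive_id.
by rewrite derive_comp// fv derive0.
Qed.

Lemma derive_chart_inj S (c : chart S) y v : chart_dom c y -> 'D_v (chart_map c) y = 0 -> v = 0.
Proof.
move=> Dy; have [cy _ _] := chart_mapK Dy.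
apply: derive_left_inverse (chart_differentiable Dy) (chart_inv_differentiable cy) _.
apply: near_open Dy _; first exact: chart_dom_open.
by move=> z /chart_mapK[].
Qed.

(** The inverse of F is smooth only through local extensions g; still, g o F o [chart_map c] equals
    [chart_map c] near y, and the chain rule applies to this open set of parameters. *)
Lemma diffeomorphism_tangent S (F : V -> V) S' (c : chart S) y v :
  smooth_on setT F -> diffeomorphism S F S' -> chart_dom c y ->
  'D_('D_v (chart_map c) y) F (chart_map c y) = 0 -> v = 0.
Proof.
move=> sF [FS _ [G sG GF]] Dy Fv.
have Sy := chart_dom_chart_map Dy.
have S'y : S' (F (chart_map c y)) by rewrite -FS; exists (chart_map c y).
have [A [g [oA Ay sg gG]]] := sG _ S'y.
have dF z : differentiable F z by apply: smooth_on_differentiable sF _.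
have dc := chart_differentiable Dy.
apply: (derive_chart_inj Dy).
have gFc : \forall z \near y, ((g \o F) \o chart_map c) z = chart_map c z.
  have oD := @open_preimage_on _ _ _ _ (F \o chart_map c) _ (@chart_dom_open _ _ c) oA.
  apply: (near_open (oD _) (x := y)) => //.
    apply: (smooth_on_compV (@chart_dom_open _ _ c) openT _ sF) => //.
    exact: chart_map_smooth.
  move=> z [Dz Az] /=; have Sz := chart_dom_chart_map Dz.
  by rewrite gG// ?GF// -FS; exists (chart_map c z).
rewrite -(near_eq_derive v gFc) derive_comp//; last first.
  by apply: differentiable_comp => //; exact: smooth_on_differentiable Ay.
rewrite derive_comp//; last exact: smooth_on_differentiable Ay.
by rewrite Fv derive0.
Qed.

End Tangent.

(** * Reflections and the invertibility of I + Dr *)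

Section Reflection.
Variable R : realType.
Local Notation V := 'rV[R]_3.
Implicit Types (u v w d : V) (r : Cb R).

(** For d = 0 this is the identity, which is the right value when the two vectors to be exchanged
    coincide. *)
Definition householder d : 'M[R]_3 := 1%:M - (2 / dot d d) *: (d^T *m d).

Lemma mulmx_householder d u : u *m householder d = u - (2 / dot d d * dot u d) *: d.
Proof.
rewrite mulmxBr mulmx1 -scalemxAr mulmxA -scalerA; congr (_ - _ *: _).
apply/rowP => k; rewrite !mxE big_ord1 !mxE; congr (_ * _).
by apply: eq_bigr => i _; rewrite mxE.
Qed.

Lemma householderK d u : u *m householder d *m householder d = u.
Proof.
rewrite !mulmx_householder.
have [->|d0] := eqVneq d 0; first by rewrite !scaler0 !subr0.
have dd : dot d d != 0 by rewrite gt_eqF// dot_gt0.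
rewrite -addrA -opprD -scalerDl -[X in dot (_ + X) _]scaleNr dotDl dotZl.
rewrite [X in X *: d](_ : _ = 0); first by rewrite scale0r subr0.
by field.
Qed.

Lemma enorm_householder d u : enorm (u *m householder d) = enorm u.
Proof.
congr Num.sqrt; rewrite !mulmx_householder.
have [->|d0] := eqVneq d 0; first by rewrite !scaler0 !subr0.
have dd : dot d d != 0 by rewrite gt_eqF// dot_gt0.
by rewrite -scaleNr !(dotDl, dotDr, dotZl, dotZr) (dotC d u); field.
Qed.

(** Equal lengths give |w - v|^2 = 2 w.(w - v), so exactly one copy of w - v is subtracted from
    w. *)
Lemma householder_swap v w : dot v v = dot w w -> w *m householder (w - v) = v.
Proof.
move=> vw; rewrite mulmx_householder; have [/eqP|d0] := eqVneq (w - v) 0.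
  by rewrite subr_eq0 => /eqP ->; rewrite subrr scaler0 subr0.
have := dot_gt0 d0; have -> : dot (w - v) (w - v) = 2 * dot w (w - v).
  by rewrite -scaleN1r !(dotDl, dotDr, dotZl, dotZr) vw (dotC v w); ring.
rewrite pmulr_rgt0// => w0; rewrite (_ : _ * _ = 1).
  by rewrite scale1r opprB addrCA subrr addr0.
by rewrite invfM mulrA divff ?pnatr_eq0// mul1r mulVf// gt_eqF.
Qed.

Lemma derive_mulmxr n (h : V -> 'rV[R]_n) m (M : 'M[R]_(n, m)) x v : differentiable h x ->
  differentiable (fun y => h y *m M) x /\ 'D_v (fun y => h y *m M) x = 'D_v h x *m M.
Proof.
move=> dh.
have dE k : differentiable (fun y => (h y *m M) ord0 k) x /\
    'D_v (fun y => (h y *m M) ord0 k) x = ('D_v h x *m M) ord0 k.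
  have -> : (fun y => (h y *m M) ord0 k) = \sum_i (M i k \*: (fun y => h y ord0 i)).
    by apply/funext => y; rewrite fct_sumE mxE; apply: eq_bigr => i _; rewrite mulrC.
  have di i : differentiable (M i k \*: (fun y => h y ord0 i)) x.
    by apply: differentiableZ; exact: differentiable_entry.
  split; first exact: differentiable_sum.
  rewrite derive_sum => [|i]; last exact/diff_derivable.
  rewrite mxE; apply: eq_bigr => i _; rewrite deriveZ; last first.
    exact/diff_derivable/differentiable_entry.
  by rewrite derive_entry// mulrC.
have dM : differentiable (fun y => h y *m M) x.
  by apply: differentiable_row => k; case: (dE k).
by split=> //; apply/rowP => k; rewrite -derive_entry//; case: (dE k).
Qed.

(** The inner map is affine with constant derivative, so each differentiation merely reflects its
    direction and creates no further terms. *)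
Lemma reflect_iterD d x r vs y :
  differentiable (iterD vs (fun y => r (x + (y - x) *m householder d) *m householder d)) y /\
  iterD vs (fun y => r (x + (y - x) *m householder d) *m householder d) y =
  iterD [seq v *m householder d | v <- vs] r (x + (y - x) *m householder d) *m householder d.
Proof.
set H := householder d; pose phi y := x + (y - x) *m H.
have dphi z v : differentiable phi z /\ 'D_v phi z = v *m H.
  have dsub : differentiable (fun y : V => y - x) z by apply: differentiableB.
  have [dm Dm] := derive_mulmxr H v dsub.
  split; first by apply: differentiableD.
  rewrite deriveD; [|exact: derivable_cst|exact: diff_derivable].
  rewrite derive_cst add0r Dm deriveB; [|exact: derivable_id|exact: derivable_cst].
  by rewrite derive_id derive_cst subr0.
have step (g : V -> V) z v : differentiable g (phi z) ->
    differentiable (fun y => g (phi y) *m H) z /\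
    'D_v (fun y => g (phi y) *m H) z = 'D_(v *m H) g (phi z) *m H.
  move=> dg; have [dp Dp] := dphi z v.
  have dgp : differentiable (g \o phi) z by exact: differentiable_comp.
  have [dm ->] := derive_mulmxr H v dgp.
  split; first exact: dm.
  have Dg : 'D_v (g \o phi) z = 'D_('D_v phi z) g (phi z) := derive_comp v dp dg.
  by rewrite -[in RHS]Dp -Dg.
have dr ws z : differentiable (iterD ws r) z by exact: (@Cb_smooth _ r ws z I).
rewrite -/(phi y); suff E : forall z, iterD vs (fun y => r (phi y) *m H) z =
    iterD [seq v *m H | v <- vs] r (phi z) *m H.
  split=> //; have -> : iterD vs (fun y => r (phi y) *m H) =
      fun z => iterD [seq v *m H | v <- vs] r (phi z) *m H by exact/funext.
  by have [] := step _ y 0 (dr [seq v *m H | v <- vs] (phi y)).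
elim: vs => [//|v vs IH] z /=.
have -> : iterD vs (fun y => r (phi y) *m H) =
      fun z => iterD [seq v *m H | v <- vs] r (phi z) *m H by exact/funext.
by have [_ ->] := step _ z v (dr [seq v *m H | v <- vs] (phi z)).
Qed.

Lemma reflect_subproof d x r :
  (fun y => r (x + (y - x) *m householder d) *m householder d) \in @Cb_pred R.
Proof.
apply/asboolP; split=> [vs y _|p]; first by have [] := reflect_iterD d x r vs y.
have [M rM] := Cb_bound p r; exists M => vs y [vsp vs1].
have [_ ->] := reflect_iterD d x r vs y; rewrite enorm_householder; apply: rM.
split; first by rewrite size_map vsp.
by move=> _ /mapP[v /vs1 v1 ->]; rewrite enorm_householder.
Qed.

(** With phi the affine reflection fixing x, this is the r' for which I + r' = phi o (I + r) o
    phi. *)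
Definition reflect d x r : Cb R := MkCb (reflect_subproof d x r).

Lemma reflectK d x r : reflect d x (reflect d x r) = r.
Proof.
apply: val_inj; apply/funext => y /=.
by rewrite householderK addrAC subrr add0r householderK addrC subrK.
Qed.

Lemma Cb_seminorm_reflect_le k d x r : Cb_seminorm k (reflect d x r) <= Cb_seminorm k r.
Proof.
apply: Cb_seminorm_le => vs y [vsk vs1] /=.
have [_ ->] := reflect_iterD d x r vs y; rewrite enorm_householder.
apply: Cb_seminorm_ub; split; first by rewrite size_map.
by move=> _ /mapP[v /vs1 v1 ->]; rewrite enorm_householder.
Qed.

Lemma Cb_seminorm_reflect k d x r : Cb_seminorm k (reflect d x r) = Cb_seminorm k r.
Proof.
apply/eqP; rewrite eq_le Cb_seminorm_reflect_le /=.
by rewrite -{1}(reflectK d x r) Cb_seminorm_reflect_le.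
Qed.

Lemma Cb_seminormN k r : Cb_seminorm k (0 - r) = Cb_seminorm k r.
Proof.
have le (s : Cb R) : Cb_seminorm k (0 - s) <= Cb_seminorm k s.
  apply: Cb_seminorm_le => vs x vs1; have := iterD_Cb_lin (-1) s 0 vs x.
  rewrite !scaleN1r [- s + 0]addrC => ->.
  have -> : iterD vs ((0 : Cb R) : V -> V) x = 0.
    by have := iterD_Cb_lin (-1) 0 0 vs x; rewrite scaleN1r oppr0 addr0 scaleN1r addNr.
  by rewrite addr0 -scaleN1r enormZ normrN1 mul1r; exact: Cb_seminorm_ub.
apply/eqP; rewrite eq_le le /=; have := le (0 - r).
by rewrite sub0r sub0r opprK.
Qed.

Lemma Binfty_reflect e d x r : Binfty e r -> Binfty e (reflect d x r).
Proof.
by apply: Binfty_seminorm_eq => k; rewrite !Cb_seminormN Cb_seminorm_reflect.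
Qed.

(* Only the tangential injectivity of I + Dr is built into [admissible_radius].
   If I + Dr(x) killed some v, the conjugate of r by the reflection exchanging v
   with a tangent vector w, which has the same seminorms, would kill w. *)
Lemma det_displace_neq0 (S : set V) e r x :
  (forall x, S x -> exists c : chart S, chart_cod c x) -> admissible_radius S e ->
  Binfty e r -> S x -> \det (1%:M + Dmx r x) != 0.
Proof.
move=> hS [_ he] Br Sx; apply/negP => /eqP dA.
have : \det (1%:M + Dmx r x)^T == 0 by rewrite det_tr dA.
case/det0P => v v0 vA.
have [c cx] := hS x Sx; have [Dy ex] := chart_invK cx Sx.
set y := chart_inv c x in Dy ex; pose w := 'D_(delta_mx ord0 ord0) (chart_map c) y.
have e0 : delta_mx ord0 ord0 != 0 :> 'rV[R]_2.
  by apply/eqP => /rowP/(_ ord0)/eqP; rewrite !mxE eqxx oner_eq0.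
have w0 : w != 0 by apply: contraNN e0 => /eqP/(derive_chart_inj Dy) ->.
(* A reflection exchanges only vectors of equal length, so v is rescaled to the length of w. *)
pose v' := (enorm w / enorm v) *: v.
have nv : enorm v != 0.
  by apply: contraNN v0 => /eqP h; apply/eqP/dot_eq0; rewrite -sqr_enorm h expr0n.
have vw : dot v' v' = dot w w.
  by rewrite dotZl dotZr -!sqr_enorm mulrA -expr2 -exprMn divfK.
have rv' : 'D_v' r x = - v'.
  apply/eqP; rewrite -addr_eq0 addrC -derive_displace derive_displaceE -scalemxAl vA.
  by rewrite scaler0.
pose d := w - v'; have Br' := Binfty_reflect d x Br.
have [hd _] := he _ Br'.
apply/negP/negPn: e0; apply/eqP.
apply: (diffeomorphism_tangent (@smooth_displace _ _) hd Dy).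
rewrite -/w ex derive_displace.
have [_ E] := reflect_iterD d x r [:: w] x.
have {}E : 'D_w (reflect d x r) x = _ := E.
(* The reflection sends w to v', Dr(x) sends v' to -v', and the reflection returns -w, which cancels
   w. *)
rewrite E /= subrr mul0mx addr0 (householder_swap vw) rv' mulNmx.
by rewrite -(householder_swap vw) householderK subrr.
Qed.

End Reflection.

(** * The squared Jacobian as an expression in first partial derivatives *)

Section NormalAndJacobian.
Variable R : realType.
Local Notation V := 'rV[R]_3.

Lemma smooth_on_cross m (O : set 'rV[R]_m) (f g : 'rV[R]_m -> V) : open O ->
  smooth_on O f -> smooth_on O g -> smooth_on O (fun y => cross (f y) (g y)).
Proof.
move=> oO sf sg; apply: (smooth_on_row oO).
have sub (a b c d : 'rV[R]_m -> R) : smooth_on O a -> smooth_on O b -> smooth_on O c ->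
    smooth_on O d -> smooth_on O (fun y => a y * b y - c y * d y).
  move=> sa sb sc sd.
  apply: (@smooth_on_eq _ _ _ _ (fun y => a y * b y + -1 * (c y * d y))) => //.
    by move=> y _; rewrite mulN1r.
  apply: smooth_on_add => //; first exact: smooth_on_mul.
  by apply: smooth_on_mul => //; [exact: smooth_on_cst|exact: smooth_on_mul].
have sfi i := smooth_on_entry i oO sf; have sgi i := smooth_on_entry i oO sg.
apply: ord3P.
- apply: smooth_on_eq (sub _ _ _ _ (sfi _) (sgi _) (sfi _) (sgi _)) => // y _.
  by rewrite cross0.
- apply: smooth_on_eq (sub _ _ _ _ (sfi _) (sgi _) (sfi _) (sgi _)) => // y _.
  by rewrite cross1.
- apply: smooth_on_eq (sub _ _ _ _ (sfi _) (sgi _) (sfi _) (sgi _)) => // y _.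
  by rewrite cross2.
Qed.

Variable S : set V.
Implicit Types c : chart S.

Definition chart_tangent c (k : 'I_2) y : V := 'D_(delta_mx ord0 k) (chart_map c) y.

Definition chart_cross c y : V :=
  cross (chart_tangent c ord0 y) (chart_tangent c (lift ord0 ord0) y).

Lemma smooth_chart_tangent c k : smooth_on (chart_dom c) (chart_tangent c k).
Proof. exact/smooth_on_derive/chart_map_smooth. Qed.

Lemma chart_cross_neq0 c y : chart_dom c y -> chart_cross c y != 0.
Proof.
move=> Dy; apply: cross_neq0 => s t.
have dc := chart_differentiable Dy.
rewrite /chart_tangent !deriveE// -!linearZ -linearD /= -deriveE//.
move=> /(derive_chart_inj Dy)/rowP E.
have := E ord0; have := E (lift ord0 ord0).
by rewrite !mxE /= !mulr1 !mulr0 ?addr0 ?add0r => -> ->.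
Qed.

Variable n : V -> V.
Hypothesis hn : outer_unit_normal S n.

Lemma normal_chart_cross c y : chart_dom c y ->
  exists s, n (chart_map c y) = s *: chart_cross c y /\
    s ^+ 2 * dot (chart_cross c y) (chart_cross c y) = 1.
Proof.
move=> Dy; have [n1 nT _] := hn (chart_dom_chart_map Dy).
by apply: unit_normal_cross (chart_cross_neq0 Dy) n1 _ _; exact: nT.
Qed.

Lemma chart_smooth_normal i j : chart_smooth S (fun x => n x ord0 i * n x ord0 j).
Proof.
move=> c; have oD := @chart_dom_open _ _ c.
have sN : smooth_on (chart_dom c) (chart_cross c).
  by apply: smooth_on_cross => //; exact: smooth_chart_tangent.
have sNi k := smooth_on_entry k oD sN.
have sNN : smooth_on (chart_dom c) (fun y => dot (chart_cross c y) (chart_cross c y)).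
  apply: (smooth_on_eq oD (fun y _ => esym (dot3 _ _))).
  by do ?apply: (smooth_on_add oD); apply: (smooth_on_mul oD).
have NN0 y : chart_dom c y -> dot (chart_cross c y) (chart_cross c y) != 0.
  by move=> /chart_cross_neq0/dot_gt0/gt_eqF ->.
apply: (smooth_on_eq oD _ (smooth_on_mul oD (smooth_on_mul oD (sNi i) (sNi j))
  (smooth_on_inv oD sNN NN0))) => y Dy /=.
have [s [-> s1]] := normal_chart_cross Dy; rewrite !mxE.
rewrite (_ : (dot _ _)^-1 = s ^+ 2); first by ring.
by apply: (mulIf (NN0 _ Dy)); rewrite mulVf ?NN0.
Qed.

Variable e : R.
Hypothesis he : admissible_radius S e.
Hypothesis hS : forall x, S x -> exists c : chart S, chart_cod c x.

(** Hides the expression, so that determinants and minors are handled by closure rules instead of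
    being written out in the syntax. *)
Definition representable (G : Cb R -> V -> R) :=
  exists2 E, wf S (Binfty e) E & forall r x, eval E r x = G r x.

Lemma representable_cst g : chart_smooth S g -> representable (fun _ x => g x).
Proof. by move=> sg; exists (ECst g). Qed.

Lemma representable_add F G : representable F -> representable G ->
  representable (fun r x => F r x + G r x).
Proof. by move=> [a wa Fa] [b wb Gb]; exists (EAdd a b) => //= r x; rewrite Fa Gb. Qed.

Lemma representable_mul F G : representable F -> representable G ->
  representable (fun r x => F r x * G r x).
Proof. by move=> [a wa Fa] [b wb Gb]; exists (EMul a b) => //= r x; rewrite Fa Gb. Qed.

Lemma representable_eq F G : (forall r x, F r x = G r x) -> representable F -> representable G.
Proof. by move=> FG [a wa Fa]; exists a => // r x; rewrite Fa. Qed.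

Lemma representable_const (a : R) : representable (fun _ _ => a).
Proof. by apply: representable_cst => c; exact: smooth_on_cst. Qed.

Lemma representable_sum (I : Type) (s : seq I) (F : I -> Cb R -> V -> R) :
  (forall i, representable (F i)) -> representable (fun r x => \sum_(i <- s) F i r x).
Proof.
move=> rF; elim: s => [|i s IH].
  by apply: representable_eq (representable_const 0) => r x; rewrite big_nil.
by apply: representable_eq (representable_add (rF i) IH) => r x; rewrite big_cons.
Qed.

Lemma representable_prod (I : Type) (s : seq I) (F : I -> Cb R -> V -> R) :
  (forall i, representable (F i)) -> representable (fun r x => \prod_(i <- s) F i r x).
Proof.
move=> rF; elim: s => [|i s IH].
  by apply: representable_eq (representable_const 1) => r x; rewrite big_nil.
by apply: representable_eq (representable_mul (rF i) IH) => r x; rewrite big_cons.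
Qed.

Lemma representable_det m (M : Cb R -> V -> 'M[R]_m) :
  (forall i j, representable (fun r x => M r x i j)) -> representable (fun r x => \det (M r x)).
Proof.
move=> rM; apply: representable_sum => s.
apply: representable_mul; first exact: representable_const.
by apply: representable_prod => i; exact: rM.
Qed.

Lemma DmxE r i j x : Dmx (r : Cb R) x i j = partial r i j x.
Proof.
rewrite !mxE /partial deriveE//; apply: (smooth_on_differentiable (@Cb_smooth _ r)) => //.
Qed.

Definition sqr_jac (r : Cb R) x := let w := n x *m \adj (1%:M + Dmx r x) in dot w w.

Lemma representable_sqr_jac : representable sqr_jac.
Proof.
have radj i j : representable (fun r x => (\adj (1%:M + Dmx r x)) i j).
  apply: (representable_eq (F := fun r x => (-1) ^+ (j + i) *
     \det (row' j (col' i (1%:M + Dmx r x))))) => [r x|]; first by rewrite mxE.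
  apply: representable_mul; first exact: representable_const.
  apply: representable_det => k l.
  apply: (representable_eq (F := fun r x => (lift j k == lift i l)%:R +
     partial r (lift j k) (lift i l) x)) => [r x|].
    by rewrite 2!mxE [in RHS]mxE DmxE mxE.
  by apply: representable_add; [exact: representable_const|exists (ELin R (lift j k) (lift i l))].
apply: (representable_eq (F := fun r x => \sum_k \sum_i \sum_l (n x ord0 i * n x ord0 l) *
    ((\adj (1%:M + Dmx r x)) i k * (\adj (1%:M + Dmx r x)) l k))) => [r x|].
  apply: eq_bigr => k _; rewrite mxE big_distrl; apply: eq_bigr => i _.
  by rewrite big_distrr; apply: eq_bigr => l _; rewrite mulrACA.
do 3 (apply: representable_sum => ?).
by apply: representable_mul; [exact/representable_cst/chart_smooth_normal|exact: representable_mul].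
Qed.

(** For a singular matrix [omega] is 0, whereas the adjugate may be nonzero; hence the appeal to
    [det_displace_neq0]. *)
Lemma omegaE r x : Binfty e r -> S x -> omega n r x = n x *m \adj (1%:M + Dmx r x).
Proof.
move=> Br Sx; have dA := det_displace_neq0 hS he Br Sx.
rewrite /omega /= /invmx unitmxE unitfE dA -scalemxAr scalerA divff// scale1r.
by [].
Qed.

Lemma jacE r x : Binfty e r -> S x -> jac n r x = Num.sqrt (sqr_jac r x).
Proof. by move=> Br Sx; rewrite /jac omegaE. Qed.

(** Multiplying n adj(A) by A gives (det A) n, which is nonzero. Positivity is what allows the
    square root to be differentiated. *)
Lemma sqr_jac_gt0 r x : Binfty e r -> S x -> 0 < sqr_jac r x.
Proof.
move=> Br Sx; have dA := det_displace_neq0 hS he Br Sx.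
apply: dot_gt0; apply/eqP => nA; have [n1 _ _] := hn Sx.
have : n x *m \adj (1%:M + Dmx r x) *m (1%:M + Dmx r x) = 0 by rewrite nA mul0mx.
rewrite -mulmxA mul_adj_mx mul_mx_scalar => /eqP; rewrite scaler_eq0 (negPf dA) /= => /eqP nx0.
by move: n1; rewrite nx0 -(scale0r 0) enormZ normr0 mul0r => /eqP; rewrite eq_sym oner_eq0.
Qed.

(** The factor s is chosen before r: it comes from the normal of the undisplaced surface and stays
    constant when r varies. *)
Lemma sqr_jac_chart c y : chart_dom c y ->
  exists s, forall r : Cb R, Binfty e r ->
    let w := cross ('D_(chart_tangent c ord0 y) (displace r) (chart_map c y))
      ('D_(chart_tangent c (lift ord0 ord0) y) (displace r) (chart_map c y)) in
    sqr_jac r (chart_map c y) = s ^+ 2 * dot w w.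
Proof.
move=> Dy; have [s [nE _]] := normal_chart_cross Dy; exists s => r Br w.
have Sx := chart_dom_chart_map Dy.
have -> : w = cross (chart_tangent c ord0 y *m (1%:M + Dmx r (chart_map c y))^T)
    (chart_tangent c (lift ord0 ord0) y *m (1%:M + Dmx r (chart_map c y))^T).
  by congr cross; exact: derive_displaceE.
rewrite -(cross_mulmx_tr _ _ (det_displace_neq0 hS he Br Sx)).
rewrite /sqr_jac -(omegaE Br Sx) /omega nE -scalemxAl [_ *: (s *: _)]scalerA mulrC -scalerA.
by rewrite dotZl dotZr mulrA -expr2.
Qed.

End NormalAndJacobian.

(** * The surface divergence in terms of tangent vectors *)

Section Divergence.
Variable R : realType.
Local Notation V := 'rV[R]_3.

Lemma dot_mulmx_tr (u v : V) (M : 'M[R]_3) : dot (u *m M^T) v = dot (v *m M) u.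
Proof. by rewrite !dot3 !(mxE, sum3); ring. Qed.

Lemma sqr_cross_limit (s : R) (a a' b b' : V) :
  (fun t => t^-1 * (s * dot (cross (a + t *: a') (b + t *: b')) (cross (a + t *: a') (b + t *: b'))
     - s * dot (cross a b) (cross a b))) @ (0 : R)^' -->
  s * (2 * dot (cross a' b + cross a b') (cross a b)).
Proof.
set w := cross a b; set w1 := _ + _; set w2 := cross a' b'.
(* These are the coefficients of t^2, t^3 and t^4 in |w + t w1 + t^2 w2|^2. *)
pose B := dot w1 w1 + 2 * dot w2 w; pose C := 2 * dot w1 w2; pose D := dot w2 w2.
have t0 : (fun t : R => t) @ (0 : R)^' --> (0 : R) by exact: nbhs_dnbhs.
have cC : (fun t : R => B + t * (C + t * D)) @ (0 : R)^' --> B + 0 * (C + 0 * D).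
  apply: cvgD; first exact: cvg_cst.
  apply: (cvgM t0); apply: cvgD; first exact: cvg_cst.
  by apply: (cvgM t0); exact: cvg_cst.
have cA : (fun t : R => s * (2 * dot w1 w + t * (B + t * (C + t * D)))) @ (0 : R)^' -->
    s * (2 * dot w1 w + 0 * (B + 0 * (C + 0 * D))).
  apply: cvgM; first exact: cvg_cst.
  by apply: cvgD; [exact: cvg_cst|exact: cvgM].
move: cA; rewrite mul0r addr0; apply: cvg_eq_near.
have : \forall t \near (0 : R)^', t != 0 by exact: nbhs_dnbhs_neq.
apply: filterS => t tn0.
have -> : cross (a + t *: a') (b + t *: b') = w + t *: w1 + t ^+ 2 *: w2.
  rewrite crossDl !crossDr !crossZl !crossZr scalerA -expr2 scalerDr.
  by rewrite -!addrA; congr (_ + _); rewrite addrCA.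
rewrite /B /C /D; clearbody w w1 w2.
rewrite !(dotDl, dotDr, dotZl, dotZr) (dotC w w1) (dotC w w2) (dotC w2 w1).
by field.
Qed.

Variables (S : set V) (e : R).
Hypothesis hS : forall x, S x -> exists c : chart S, chart_cod c x.
Hypothesis he : admissible_radius S e.
Implicit Types (r xi : Cb R) (c : chart S).

Lemma displace_inj r : Binfty e r -> {in S &, injective (displace r)}.
Proof.
move=> Br; have [[_ _ [G _ GF]] _] := he.2 r Br.
by move=> x y /set_mem Sx /set_mem Sy E; rewrite -(GF x Sx) -(GF y Sy) E.
Qed.

Lemma tau_invE r xi x : Binfty e r -> S x -> tau_inv S r xi (displace r x) = xi x.
Proof. by move=> Br Sx; rewrite /tau_inv pinvKV ?inE//; exact: displace_inj. Qed.

(** Composing xi with a local extension of the inverse displacement gives an extension, so [get] in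
    [surface_div] returns a genuine one. *)
Lemma tau_inv_extension r xi x : Binfty e r -> S x ->
  exists f O, local_extension (displace r @` S) (tau_inv S r xi) (displace r x) O f.
Proof.
move=> Br Sx; have [[_ _ [G sG GF]] _] := he.2 r Br.
have [A [g [oA Ax sg gG]]] := sG _ (ex_intro2 _ _ x Sx erefl).
exists (xi \o g), A; split=> //.
  exact: (smooth_on_compV oA openT sg (@Cb_smooth _ xi)).
move=> w Aw [z Sz zw]; have S'w : (displace r @` S) w by exists z.
by rewrite -[in RHS]zw tau_invE//= gG// -zw GF.
Qed.

Variables (nr : Cb R -> V -> V).
Hypothesis hnr : forall r, Binfty e r -> outer_unit_normal (displace r @` S) (nr r).

(** The normal is orthogonal by definition to the velocities of charts of the image surface, so the
    displaced chart is first factored through such a chart. *)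
Lemma normal_image_tangent r c y v : Binfty e r -> chart_dom c y ->
  dot (nr r (displace r (chart_map c y)))
    ('D_('D_v (chart_map c) y) (displace r) (chart_map c y)) = 0.
Proof.
move=> Br Dy; have [_ [_ _ hS']] := he.2 r Br.
have Sy := chart_dom_chart_map Dy.
have S'y : (displace r @` S) (displace r (chart_map c y)) by exists (chart_map c y).
have [c' c'x] := hS' _ S'y; have [D'y E'] := chart_invK c'x S'y.
have [_ nT _] := hnr Br S'y.
have dc := chart_differentiable Dy.
have dF := @differentiable_displace _ r.
have dFc : differentiable (displace r \o chart_map c) y by exact: differentiable_comp.
pose g := chart_inv c' \o (displace r \o chart_map c).
have dg : differentiable g y.
  by apply: differentiable_comp => //; exact: chart_inv_differentiable.
have gE : \forall z \near y, (chart_map c' \o g) z = (displace r \o chart_map c) z.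
  have sFc : smooth_on (chart_dom c) (displace r \o chart_map c).
    apply: (smooth_on_compV (@chart_dom_open _ _ c) openT _ (@smooth_displace _ r)) => //.
    exact: chart_map_smooth.
  have oD := open_preimage_on (@chart_dom_open _ _ c) (@chart_cod_open _ _ c') sFc.
  apply: (near_open oD (x := y)) => // z [Dz c'z].
  have S'z : (displace r @` S) ((displace r \o chart_map c) z).
    by exists (chart_map c z) => //; exact: chart_dom_chart_map.
  exact: (chart_invK c'z S'z).2.
rewrite -(derive_comp v dc (dF _)) -(near_eq_derive v gE).
rewrite (derive_comp v dg (chart_differentiable D'y)).
exact: nT.
Qed.

(** The chosen extension is arbitrary, but its gradient M satisfies a' = aM and b' = bM; by
    [trace_cross], these values determine the divergence. *)
Lemma surface_div_chart r xi c y a b a' b' (x := chart_map c y) :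
  Binfty e r -> chart_dom c y ->
  a = 'D_(chart_tangent c ord0 y) (displace r) x ->
  b = 'D_(chart_tangent c (lift ord0 ord0) y) (displace r) x ->
  a' = 'D_(chart_tangent c ord0 y) xi x ->
  b' = 'D_(chart_tangent c (lift ord0 ord0) y) xi x ->
  0 < dot (cross a b) (cross a b) /\
  dot (cross a b) (cross a b) *
    surface_div (displace r @` S) (nr r) (tau_inv S r xi) (displace r x) =
  dot (cross a' b + cross a b') (cross a b).
Proof.
move=> Br Dy aE bE a'E b'E; have Sx := chart_dom_chart_map Dy.
have dc := chart_differentiable Dy.
have dF := @differentiable_displace _ r.
have ab0 : cross a b != 0.
  apply: cross_neq0 => s t; rewrite aE bE !(deriveE _ (dF _)).
  rewrite -!linearZ -linearD /= /chart_tangent !(deriveE _ dc) -!linearZ -linearD /=.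
  rewrite -(deriveE _ dc) -(deriveE _ (dF _)).
  move=> /(diffeomorphism_tangent (@smooth_displace _ r) (he.2 r Br).1 Dy)/rowP E.
  have := E ord0; have := E (lift ord0 ord0).
  by rewrite !mxE /= !mulr1 !mulr0 ?addr0 ?add0r => -> ->.
split; first exact: dot_gt0.
rewrite /surface_div; set f := get _.
have [A [oA Ax sf fu]] : exists O,
    local_extension (displace r @` S) (tau_inv S r xi) (displace r x) O f.
  by have := getPex (tau_inv_extension xi Br Sx).
have df : differentiable f (displace r x) by exact: (smooth_on_differentiable sf).
(* Along the chart, the extension composed with the displacement coincides with xi; both sides are
   coordinate derivatives of this map. *)
have tangentE k : 'D_(chart_tangent c k y) xi x =
    'D_(chart_tangent c k y) (displace r) x *m grad f (displace r x).
  rewrite -(derive_jacobian _ df) -(derive_comp _ dc (dF _)).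
  have dFc : differentiable (displace r \o chart_map c) y by exact: differentiable_comp.
  rewrite -(derive_comp _ dFc df).
  have dxi : differentiable xi x by exact: (smooth_on_differentiable (@Cb_smooth _ xi)).
  rewrite -(derive_comp _ dc dxi); apply: near_eq_derive.
  have sFc : smooth_on (chart_dom c) (displace r \o chart_map c).
    apply: (smooth_on_compV (@chart_dom_open _ _ c) openT _ (@smooth_displace _ r)) => //.
    exact: chart_map_smooth.
  have oD := open_preimage_on (@chart_dom_open _ _ c) oA sFc.
  apply: (near_open oD (x := y)) => // z [Dz Az] /=.
  have Sz := chart_dom_chart_map Dz.
  by rewrite fu ?tau_invE//; exists (chart_map c z).
have S'x : (displace r @` S) (displace r x) by exists x.
have [n1 _ _] := hnr Br S'x.
have na := normal_image_tangent (delta_mx ord0 ord0) Br Dy.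
have nb := normal_image_tangent (delta_mx ord0 (lift ord0 ord0)) Br Dy.
rewrite -[X in dot _ X]aE in na; rewrite -[X in dot _ X]bE in nb.
have [s [nE s1]] := unit_normal_cross ab0 n1 na nb.
have aM : a' = a *m grad f (displace r x) by rewrite a'E aE; exact: tangentE.
have bM : b' = b *m grad f (displace r x) by rewrite b'E bE; exact: tangentE.
rewrite aM bM -(trace_cross a b (grad f (displace r x))) /div mxtrace_tr mulrBr.
(* The normal enters quadratically, so s appears squared and cancels the factor |a x b|^2. *)
congr (_ - _); rewrite dot_mulmx_tr nE -scalemxAl dotZl dotZr.
have H (W q : R) : W * (s * (s * q)) = s ^+ 2 * W * q by ring.
by rewrite H s1 mul1r.
Qed.

End Divergence.

Theorem lemma4p1 (R : realType) (Omega Gamma : set 'rV[R]_3)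
  (n : 'rV[R]_3 -> 'rV[R]_3) (e : R) (nr : Cb R -> 'rV[R]_3 -> 'rV[R]_3)
  (hOmega : bounded_domain Omega) (hGamma : Gamma = boundary Omega)
  (hsurf : smooth_closed_surface Gamma) (hsc : simply_connected Gamma)
  (hn : outer_unit_normal Gamma n)
  (he : admissible_radius Gamma e)
  (hnr : forall r : Cb R, Binfty e r ->
     outer_unit_normal (displace r @` Gamma) (nr r)) :
  [/\ forall (r : Cb R) x, Binfty e r -> Gamma x ->
        Jmap Gamma n r x = jac n r x,
      gateaux_Cinfty (Binfty e) (Jmap Gamma n) &
      forall (r0 xi : Cb R) x, Binfty e r0 -> Gamma x ->
        gateaux (Jmap Gamma n) r0 xi x =
        Jmap Gamma n r0 x *
        tau r0 (surface_div (displace r0 @` Gamma) (nr r0)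
                            (tau_inv Gamma r0 xi)) x].
Proof.
have [_ _ hS] := hsurf.
have [E wE EP] := representable_sqr_jac hn e.
have sqr0 (r : Cb R) x : Binfty e r -> Gamma x -> 0 < eval E r x.
  by move=> Br Gx; rewrite EP; exact: (sqr_jac_gt0 hn he hS).
have wS : wf Gamma (Binfty e) (ESqrt E) by split.
have jacP (r : Cb R) x : Binfty e r -> Gamma x -> jac n r x = eval (ESqrt E) r x.
  by move=> Br Gx; rewrite (jacE n he hS Br Gx) /= EP.
have JE (r : Cb R) : Binfty e r -> Jmap Gamma n r = to_map Gamma (ESqrt E) r.
  by move=> Br; apply: to_Csurf_eq => x; exact: jacP.
have line := @Binfty_line R e.
have J1 (r : Cb R) x : Binfty e r -> Gamma x -> Jmap Gamma n r x = jac n r x.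
  by move=> Br Gx; rewrite JE// (to_mapE hS wS Br Gx) jacP.
split=> [//||r xi x Br Gx]; first exact: (gateaux_Cinfty_expr hS line wS JE).
rewrite (gateauxE hS line wS JE xi Br) (to_mapE hS (wf_deriv xi wS) Br Gx).
have [c cx] := hS x Gx; have [Dy xE] := chart_invK cx Gx.
have [s sP] := sqr_jac_chart hn he hS Dy; rewrite -xE in Gx *.
move: (chart_inv c x) Dy sP Gx => y Dy sP Gx {cx xE x}; set x := chart_map c y.
pose a := 'D_(chart_tangent c ord0 y) (displace r) x.
pose b := 'D_(chart_tangent c (lift ord0 ord0) y) (displace r) x.
pose a' := 'D_(chart_tangent c ord0 y) xi x.
pose b' := 'D_(chart_tangent c (lift ord0 ord0) y) xi x.
have [w0 divE] := surface_div_chart he hnr Br Dy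
  (erefl : a = _) (erefl : b = _) (erefl : a' = _) (erefl : b' = _).
have sPr : sqr_jac n r x = s ^+ 2 * dot (cross a b) (cross a b) := sP _ Br.
(* The formal derivative and the expansion of the cross product are limits of the same quotients,
   hence equal. *)
have dE : eval (deriv E xi) r x = s ^+ 2 * (2 * dot (cross a' b + cross a b') (cross a b)).
  have l1 := deriv_limit hS line (xi := xi) wE Br Gx.
  have l2 := @sqr_cross_limit R (s ^+ 2) a a' b b'.
  have l3 : (fun t => t^-1 * (eval E (r + t *: xi) x - eval E r x)) @ (0 : R)^' -->
      s ^+ 2 * (2 * dot (cross a' b + cross a b') (cross a b)).
    apply: cvg_eq_near l2; have := near0_U line xi Br; apply: filterS => t Bt.
    have dt v : 'D_v (displace (r + t *: xi : Cb R)) x = 'D_v (displace r) x + t *: 'D_v xi x.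
      rewrite !derive_displace -addrA; congr (_ + _).
      have -> : r + t *: xi = (t *: xi + r : Cb R) by exact: addrC.
      exact: etrans (iterD_Cb_lin t xi r [:: v] x) (addrC _ _).
    have := sP _ Bt; rewrite (dt (chart_tangent c ord0 y)).
    by rewrite (dt (chart_tangent c (lift ord0 ord0) y)) !EP sPr => ->.
  exact: etrans (esym (cvg_lim (@Rhausdorff R) l1)) (cvg_lim (@Rhausdorff R) l3).
rewrite J1// jacP// /tau /= dE.
have := sqr0 r x Br Gx; rewrite EP sPr => q0.
have sq0 : Num.sqrt (s ^+ 2 * dot (cross a b) (cross a b)) != 0 by rewrite gt_eqF// sqrtr_gt0.
(* Multiplication by |a x b|^2 turns the divergence into a cross product expression; multiplication
   by sqrt P then clears the root. *)
apply: (mulIf (lt0r_neq0 w0)); rewrite -[RHS]mulrA [X in _ = _ * X]mulrC divE.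
apply: (mulIf sq0); rewrite [RHS]mulrAC -expr2 sqr_sqrtr; last exact: ltW.
by field.
Qed.
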